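(* For every finite group $\Gamma$, there exists a convex polytope $P$ whose face lattice has combinatorial automorphism group isomorphic to $\Gamma$; specifically, the finite spherical abstract polytope with automorphism group $\Gamma$ provided by Theorem 1 can be realized as the face lattice of a convex polytope.
   Context: The face lattice of a convex polytope $P$ is the set of its faces (including $\emptyset$ and $P$), ordered by inclusion; its combinatorial automorphism group is the group of inclusion-preserving bijections of the face lattice. Theorem 1 states: if $\Gamma$ is a finite group isomorphic to a subgroup of $S_{n+1}$, there is a finite abstract polytope of rank $d\le n$ with automorphism group $\Gamma$, isomorphic to a face-to-face tessellation of the $(d-1)$-sphere by topological copies of convex $(d-1)$-polytopes.
   Formalization: The case n = 2 with Γ of order 3 is excluded from the claim about the polytope of Theorem 1: C_3 embeds in S_3, but no abstract polytope of rank at most 2 has automorphism group C_3. C_3 is still covered by the existence claim and with n ≥ 3. *)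

(* Defs.v *)
From HB Require Import structures.
From mathcomp Require Import all_boot all_order all_algebra all_fingroup.
From mathcomp Require Import all_classical all_reals.
From mathcomp Require Import topology normedtype.

Set Implicit Arguments.
Unset Strict Implicit.
Unset Printing Implicit Defensive.

Import Order.TTheory GRing.Theory Num.Theory.
Import numFieldNormedType.Exports.

Local Open Scope classical_set_scope.
Local Open Scope order_scope.
Local Open Scope ring_scope.

(* An automorphism preserves and reflects the order; on a finite poset every
   order-preserving bijection does. *)
Definition is_order_aut (disp : Order.disp_t) (T : porderType disp)
    (f : T -> T) : Prop :=
  bijective f /\ {mono f : x y / (x <= y)%O}.

Record order_aut (disp : Order.disp_t) (T : porderType disp) : Type := OrderAut {
  order_aut_val :> T -> T;
  _ : `[< is_order_aut order_aut_val >] }.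

HB.instance Definition _ (disp : Order.disp_t) (T : porderType disp) :=
  [isSub for @order_aut_val disp T].
HB.instance Definition _ (disp : Order.disp_t) (T : porderType disp) :=
  [Choice of order_aut T by <:].

Lemma order_autP (disp : Order.disp_t) (T : porderType disp)
    (f : order_aut T) : is_order_aut (val f).
Proof. exact/asboolP/(valP f). Qed.

Lemma is_order_aut_id (disp : Order.disp_t) (T : porderType disp) :
  `[< is_order_aut (@id T) >].
Proof. by apply/asboolP; split=> //; exists id. Qed.

Lemma is_order_aut_comp (disp : Order.disp_t) (T : porderType disp)
    (f g : order_aut T) : `[< is_order_aut (val f \o val g) >].
Proof.
have [[bf mf] [bg mg]] := (order_autP f, order_autP g).
by apply/asboolP; split=> [|x y /=]; [exact: bij_comp | rewrite mf mg].
Qed.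

Lemma order_aut_has_inv (disp : Order.disp_t) (T : porderType disp)
    (f : order_aut T) :
  exists g : T -> T, cancel (val f) g /\ cancel g (val f).
Proof. by have [[g fK gK] _] := order_autP f; exists g. Qed.

Definition order_aut_inv_fun (disp : Order.disp_t) (T : porderType disp)
    (f : order_aut T) : T -> T := projT1 (cid (order_aut_has_inv f)).

Lemma order_aut_funK (disp : Order.disp_t) (T : porderType disp)
    (f : order_aut T) : cancel (val f) (order_aut_inv_fun f).
Proof. by rewrite /order_aut_inv_fun; case: cid => g []. Qed.

Lemma order_aut_inv_funK (disp : Order.disp_t) (T : porderType disp)
    (f : order_aut T) : cancel (order_aut_inv_fun f) (val f).
Proof. by rewrite /order_aut_inv_fun; case: cid => g []. Qed.

Lemma is_order_aut_inv (disp : Order.disp_t) (T : porderType disp)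
    (f : order_aut T) : `[< is_order_aut (order_aut_inv_fun f) >].
Proof.
have [_ mf] := order_autP f.
apply/asboolP; split=> [|x y].
  by exists (val f); [exact: order_aut_inv_funK | exact: order_aut_funK].
by rewrite -mf !order_aut_inv_funK.
Qed.

Definition order_aut_one (disp : Order.disp_t) (T : porderType disp) :
  order_aut T := OrderAut (is_order_aut_id T).
Definition order_aut_mul (disp : Order.disp_t) (T : porderType disp)
  (f g : order_aut T) : order_aut T :=
  OrderAut (is_order_aut_comp f g).
Definition order_aut_inv (disp : Order.disp_t) (T : porderType disp)
  (f : order_aut T) : order_aut T :=
  OrderAut (is_order_aut_inv f).

Lemma order_aut_mulA (disp : Order.disp_t) (T : porderType disp) :
  associative (@order_aut_mul disp T).
Proof. by move=> f g h; exact: val_inj. Qed.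

Lemma order_aut_mul1 (disp : Order.disp_t) (T : porderType disp) :
  left_id (order_aut_one T) (@order_aut_mul disp T).
Proof. by move=> f; exact: val_inj. Qed.

Lemma order_aut_mulr1 (disp : Order.disp_t) (T : porderType disp) :
  right_id (order_aut_one T) (@order_aut_mul disp T).
Proof. by move=> f; exact: val_inj. Qed.

Lemma order_aut_mulV (disp : Order.disp_t) (T : porderType disp) :
  left_inverse (order_aut_one T) (@order_aut_inv disp T)
    (@order_aut_mul disp T).
Proof.
by move=> f; apply: val_inj; apply/funext => x /=; rewrite order_aut_funK.
Qed.

Lemma order_aut_mulrV (disp : Order.disp_t) (T : porderType disp) :
  right_inverse (order_aut_one T) (@order_aut_inv disp T)
    (@order_aut_mul disp T).
Proof.
by move=> f; apply: val_inj; apply/funext => x /=; rewrite order_aut_inv_funK.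
Qed.

HB.instance Definition _ (disp : Order.disp_t) (T : porderType disp) :=
  isGroup.Build (order_aut T) (@order_aut_mulA disp T)
    (@order_aut_mul1 disp T) (@order_aut_mulr1 disp T)
    (@order_aut_mulV disp T) (@order_aut_mulrV disp T).

Definition group_iso (G H : groupType) : Prop :=
  exists phi : {multiplicative G -> H}, bijective phi.

Definition order_iso (disp disp' : Order.disp_t) (S : porderType disp)
    (T : porderType disp') : Prop :=
  exists2 f : S -> T, bijective f & {mono f : x y / (x <= y)%O}.

Definition is_chain (disp : Order.disp_t) (Q : finTBPOrderType disp)
    (C : {set Q}) : bool :=
  [forall x in C, forall y in C, (x >=< y)%O].

Definition is_flag (disp : Order.disp_t) (Q : finTBPOrderType disp) :
  pred {set Q} := maxset (@is_chain disp Q).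

(* Shifted by one with respect to the usual rank: \bot has height 0
   (rank -1), the atoms have height 1 (rank 0). *)
Definition height (disp : Order.disp_t) (Q : finTBPOrderType disp)
    (x : Q) : nat :=
  \max_(C : {set Q} | is_chain C && [forall z in C, (z < x)%O]) #|C|.

Definition adjacent_flags (disp : Order.disp_t) (Q : finTBPOrderType disp)
    (A B : {set Q}) : bool :=
  [&& is_flag A, is_flag B, #|A :\: B| == 1%N & #|B :\: A| == 1%N].

(* The McMullen-Schulte axioms for a finite abstract polytope of rank d.  Flags
   contain the two improper faces, hence have d + 2 elements.  Strong
   flag-connectedness: any two flags are joined by a sequence of successively
   adjacent flags all containing their intersection. *)
Definition abstract_polytope (d : nat) (disp : Order.disp_t)
    (Q : finTBPOrderType disp) : Prop :=
  [/\ forall A : {set Q}, is_flag A -> #|A| = d.+2,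
      forall A B : {set Q}, is_flag A -> is_flag B ->
        connect [rel X Y : {set Q} | [&& adjacent_flags X Y,
                   A :&: B \subset X & A :&: B \subset Y]] A B
    & forall x y : Q, (x < y)%O -> height y = (height x).+2 ->
        #|[pred z : Q | (x < z < y)%O]| = 2%N].

Definition conv_rows (R : realType) (k m : nat) (V : 'M[R]_(k, m)) :
    set 'rV[R]_m :=
  [set w *m V | w in [set w : 'rV[R]_k |
                       (forall i, 0 <= w 0 i) /\ \sum_i w 0 i = 1]].

(* One more than the dimension of the affine hull of the rows; 0 when there
   are no rows. *)
Definition affine_rank (R : realType) (k m : nat) (V : 'M[R]_(k, m)) : nat :=
  \rank (row_mx (const_mx 1 : 'cV[R]_k) V).

(* P is a convex (r-1)-polytope, the (-1)-polytope being the empty set. *)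
Definition convex_polytope (R : realType) (r m : nat) (P : set 'rV[R]_m) :
    Prop :=
  exists (k : nat) (V : 'M[R]_(k, m)), P = conv_rows V /\ affine_rank V = r.

(* The inequality <x, c> <= b is valid on P and F is where it is tight; c = 0
   yields the improper faces set0 (b = 1) and P (b = 0). *)
Definition is_face (R : realType) (m : nat) (P F : set 'rV[R]_m) : Prop :=
  exists (c : 'cV[R]_m) (b : R),
    (forall x, P x -> (x *m c) 0 0 <= b) /\
    F = [set x | P x /\ (x *m c) 0 0 = b].

Record face_lattice (R : realType) (m : nat) (P : set 'rV[R]_m) : Type :=
  FaceOf { face_set :> set 'rV[R]_m; _ : `[< is_face P face_set >] }.

HB.instance Definition _ (R : realType) (m : nat) (P : set 'rV[R]_m) :=
  [isSub for @face_set R m P].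
HB.instance Definition _ (R : realType) (m : nat) (P : set 'rV[R]_m) :=
  [Choice of face_lattice P by <:].
HB.instance Definition _ (R : realType) (m : nat) (P : set 'rV[R]_m) :=
  [SubChoice_isSubPOrder of face_lattice P by <: with set_display].

Definition homeo_on (R : realType) (m d : nat) (P : set 'rV[R]_m)
    (h : 'rV[R]_m -> 'rV[R]_d) : Prop :=
  {within P, continuous h} /\
  exists g : 'rV[R]_d -> 'rV[R]_m,
    (forall x, P x -> g (h x) = x) /\ {within h @` P, continuous g}.

(* C is the set of all faces (set0 and the whole copy included) of a
   topological copy in R^d of a convex (r-1)-polytope. *)
Definition polytope_copy (R : realType) (r d : nat)
    (C : set (set 'rV[R]_d)) : Prop :=
  exists (m : nat) (P : set 'rV[R]_m) (h : 'rV[R]_m -> 'rV[R]_d),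
    [/\ convex_polytope r P, homeo_on P h
      & C = [set h @` F | F in is_face P]].

Definition unit_sphere (R : realType) (d : nat) : set 'rV[R]_d :=
  [set x | \sum_i x 0 i ^+ 2 = 1].

Definition tile (R : realType) (d : nat) (C : set (set 'rV[R]_d)) :
  set 'rV[R]_d := \bigcup_(F in C) F.

(* A face-to-face tessellation of the (d-1)-sphere in R^d by topological copies
   of convex (d-1)-polytopes; C i is the set of faces of the i-th tile.  As
   tiles are only topological copies, face-to-face must also say that two tiles
   induce the same faces on their intersection. *)
Definition spherical_tessellation (R : realType) (d : nat) (I : finType)
    (C : I -> set (set 'rV[R]_d)) : Prop :=
  [/\ forall i, polytope_copy d (C i),
      \bigcup_i tile (C i) = @unit_sphere R d,
      forall i j, i != j ->
        C i (tile (C i) `&` tile (C j)) /\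
        tile (C i) `&` tile (C j) <> tile (C i)
    & forall i j F, F `<=` tile (C i) `&` tile (C j) -> C i F -> C j F].

(* Q is isomorphic to the poset of all faces of the tiles with a largest
   element adjoined. *)
Definition spherical (R : realType) (d : nat) (disp : Order.disp_t)
    (Q : finTBPOrderType disp) : Prop :=
  exists (I : finType) (C : I -> set (set 'rV[R]_d)) (f : Q -> set 'rV[R]_d),
    [/\ spherical_tessellation C,
        f @` [set x | x != \top%O] = \bigcup_i C i
      & forall x y : Q, x != \top%O -> y != \top%O ->
          (x <= y)%O <-> f x `<=` f y].

(* Main.v *)
Require Import Defs.
From HB Require Import structures.
From mathcomp Require Import all_boot all_order all_algebra all_fingroup.
From mathcomp Require Import all_classical all_reals.
From mathcomp Require Import topology normedtype realfun.
From mathcomp Require Import zify ring lra.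

(** A simplicial polytope with the origin in its interior is presented by its
vertices, its facets and, for each facet, the basis dual to its vertices.
Pivoting along ridges strictly increases the value of the facet functional at a
given point; hence the cones over the facets cover the space, the facets through
a given face are connected through ridges, and the faces are exactly the subsets
of the facets and the whole polytope.  This makes the face lattice an abstract
polytope, and radial projection turns the boundary complex into a tessellation
of the sphere.

Placing a new vertex beyond each facet of a set T (stacking) replaces these
facets by cones over their boundaries.  In dimension at least 3, if T covers the
vertices, the new vertices are recognized by having the smallest stars, so the
automorphisms of the stacked complex are the automorphisms of the old one that
preserve T.  Starting from the simplex, with group S_{n+1}, stack on all facets
until some facet F has trivial stabilizer, once more to separate the vertices,
and finally on all facets outside the orbit of one cone over F under the given
group: exactly that group survives.  In dimension at most 2 simplices suffice. *)

Set Implicit Arguments.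
Unset Strict Implicit.
Unset Printing Implicit Defensive.

Import Order.TTheory GRing.Theory Num.Theory.
Import numFieldNormedType.Exports.

(** * Graded posets *)

(** Stacking is iterated, so each round must re-establish the hypotheses of the next. This is why a
    polytope is given by finitely many local certificates: dual bases of the new facets can be
    written down explicitly, and all global facts follow by pivoting.

    Three points explain the last round. The stacked set is the complement of an orbit because the
    orbit of one facet may miss vertices, and stars separate old from new vertices only if every old
    vertex is covered. A trivial stabilizer is required because an automorphism preserving the orbit
    sends the chosen facet where some group element sends it, and must then equal that element. The
    complement still covers the vertices because, after a full stacking, each old facet carries [d]
    cones, at least three, of which the orbit contains at most one.

    The bound [2 < d] is also what makes stars informative: in a polygon every star has three
    elements. Polygons have dihedral groups, so the group of order 3 inside ['S_3] is out of reach
    in rank at most 2; this is the excluded case. *)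

Section GradedPoset.
Local Open Scope order_scope.
Variables (d : nat) (disp : Order.disp_t) (Q : finTBPOrderType disp).
Variable r : Q -> nat.
Hypothesis r_lt : forall x y, x < y -> (r x < r y)%N.
Hypothesis r_gap : forall x y, x < y -> ((r x).+1 < r y)%N ->
  exists z, x < z < y.
Hypothesis r0 : r \bot = 0%N.
Hypothesis r1 : r \top = d.+1.

Lemma rank_le x y : x <= y -> (r x <= r y)%N.
Proof. by rewrite le_eqVlt => /predU1P[->//|/r_lt/ltnW]. Qed.

Lemma comparable_rank_lt x y : x >=< y -> (r x < r y)%N -> x < y.
Proof.
by case: comparableP => // [/r_lt|->]; [move=> h1 _ h2; lia | rewrite ltnn].
Qed.

Lemma comparable_rank_inj x y : x >=< y -> r x = r y -> x = y.
Proof. by case: comparableP => // /r_lt; lia. Qed.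

Lemma comparable_rank_le x y : x >=< y -> (r x <= r y)%N -> x <= y.
Proof.
by rewrite leq_eqVlt => xy /predU1P[/(comparable_rank_inj xy)->//|];
   move/(comparable_rank_lt xy)/ltW.
Qed.

Lemma rank_fill x y k : x < y -> (r x < k < r y)%N ->
  exists2 z, x < z < y & r z = k.
Proof.
have [n] := ubnP (r y - r x); elim: n x y => // n IH x y hn xy hk.
have [|z /andP[xz zy]] := r_gap xy; first by lia.
have [rxz rzy] := (r_lt xz, r_lt zy).
have [hz|hz|<-] := ltngtP (r z) k.
- have [|||t /andP[zt ty] <-] := IH z y => //; try lia.
  by exists t => //; rewrite (lt_trans xz zt).
- have [|||t /andP[xt tz] <-] := IH x z => //; try lia.
  by exists t => //; rewrite xt (lt_trans tz zy).
- by exists z => //; rewrite xz.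
Qed.

Lemma is_chainP (C : {set Q}) :
  reflect {in C &, forall x y, x >=< y} (is_chain C).
Proof.
apply: (iffP forall_inP) => [h x y xC yC|h x xC].
  by have /forall_inP := h x xC; apply.
by apply/forall_inP => y yC; exact: h.
Qed.

Lemma flag_exists (C : {set Q}) : is_chain C ->
  exists2 A : {set Q}, is_flag A & C \subset A.
Proof. by move=> /maxset_exists[A]; exists A. Qed.

Lemma flag_chain (A : {set Q}) : is_flag A -> {in A &, forall x y, x >=< y}.
Proof. by move=> /maxsetP[/is_chainP]. Qed.

Lemma chainU1 (C : {set Q}) z : is_chain C -> {in C, forall w, z >=< w} ->
  is_chain (z |: C).
Proof.
move=> /is_chainP cC hz; apply/is_chainP => x y /setU1P[->|xC] /setU1P[->|yC].
- exact: comparablexx.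
- exact: hz.
- by rewrite comparable_sym; exact: hz.
- exact: cC.
Qed.

Lemma flag_max (A : {set Q}) z : is_flag A -> {in A, forall w, z >=< w} ->
  z \in A.
Proof.
move=> /maxsetP[cA mA] hz.
by have <- := mA _ (chainU1 cA hz) (finset.subsetUr _ _); rewrite setU11.
Qed.

Lemma flag_bot (A : {set Q}) : is_flag A -> \bot \in A.
Proof. by move=> fA; apply: flag_max => // w _; rewrite /Order.comparable le0x. Qed.

Lemma flag_top (A : {set Q}) : is_flag A -> \top \in A.
Proof.
by move=> fA; apply: flag_max => // w _; rewrite /Order.comparable lex1 orbT.
Qed.

(** If rank [k] were missing, take the highest element of the flag below [k] and the lowest above
    it. An element of rank [k] between these two is comparable with the whole flag, against
    maximality. *)
Lemma flag_rank (A : {set Q}) k : is_flag A -> (k <= d.+1)%N ->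
  exists2 z, z \in A & r z = k.
Proof.
move=> fA kd; apply/not_exists2P; apply: contrapT => hA.
have hk z : z \in A -> r z != k.
  by move=> zA; apply/eqP => rz; apply: hA => /(_ z)[].
have k0 : (0 < k)%N by have := hk _ (flag_bot fA); rewrite r0; lia.
have k1 : (k < d.+1)%N by have := hk _ (flag_top fA); rewrite r1; lia.
have b0 : (\bot \in A) && (r \bot < k)%N by rewrite flag_bot // r0.
have t0 : (\top \in A) && (k < r \top)%N by rewrite flag_top // r1.
case: (@arg_maxnP _ \bot [pred z | (z \in A) && (r z < k)%N] r b0) => x.
case: (@arg_minnP _ \top [pred z | (z \in A) && (k < r z)%N] r t0) => y.
move=> /= /andP[yA ry] my /andP[xA rx] mx.
have cA := flag_chain fA.
have xy : x < y by apply: comparable_rank_lt; [exact: cA|lia].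
have rxy : (r x < k < r y)%N by rewrite rx ry.
have [z /andP[xz zy] rz] := rank_fill xy rxy.
suff zA : z \in A by have := hk z zA; rewrite rz eqxx.
apply: flag_max => // w wA.
have := hk w wA; case: (ltngtP (r w) k) => // rw _.
  suff wx : w <= x by rewrite /Order.comparable (le_trans wx (ltW xz)) orbT.
  have := mx w; rewrite wA rw => /(_ isT) le_wx.
  exact: comparable_rank_le (cA _ _ wA xA) le_wx.
suff yw : y <= w by rewrite /Order.comparable (le_trans (ltW zy) yw).
have := my w; rewrite wA rw => /(_ isT) le_yw.
exact: comparable_rank_le (cA _ _ yA wA) le_yw.
Qed.

Lemma rank_bound x : (r x < d.+2)%N.
Proof. by rewrite ltnS -r1 rank_le ?lex1. Qed.

Definition rank_ord x : 'I_d.+2 := Ordinal (rank_bound x).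

Lemma rank_ord_inj (A : {set Q}) : is_chain A -> {in A &, injective rank_ord}.
Proof.
move=> /is_chainP cA x y xA yA [rxy].
by apply: comparable_rank_inj rxy; exact: cA.
Qed.

Lemma flag_card (A : {set Q}) : is_flag A -> #|A| = d.+2.
Proof.
move=> fA; have cA : is_chain A by case/maxsetP: fA.
rewrite -(card_in_imset (rank_ord_inj cA)) -[RHS]card_ord -cardsT.
congr #|pred_of_set _|; apply/setP => k; rewrite inE.
have [z zA rz] := flag_rank fA (ltn_ord k).
by apply/imsetP; exists z => //; exact: val_inj.
Qed.

Lemma card_lt_ord n k : (k <= n)%N -> #|[set i : 'I_n | (i < k)%N]| = k.
Proof.
move=> kn; have wi : injective (widen_ord kn) by move=> i j [/val_inj].
rewrite -[RHS]card_ord -(card_imset _ wi).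
congr #|pred_of_set _|; apply/setP => i; rewrite inE; apply/idP/imsetP => [ik|[j _ ->]].
  by exists (Ordinal ik) => //; exact: val_inj.
by rewrite /= ltn_ord.
Qed.

(** Ranks are distinct along a chain, which bounds chains below [x] by [r x]; the part below [x] of
    a flag through [x] attains the bound because flags meet every rank. *)
Lemma height_rank x : height x = r x.
Proof.
have rd : (r x <= d.+2)%N by rewrite ltnW ?rank_bound.
apply/eqP; rewrite eqn_leq; apply/andP; split.
  apply/bigmax_leqP => C /andP[cC /forall_inP ltC].
  rewrite -(card_in_imset (rank_ord_inj cC)) -[leqRHS](card_lt_ord rd).
  by apply/subset_leq_card/fintype.subsetP => _ /imsetP[z zC ->]; rewrite inE /= r_lt ?ltC.
have c1 : is_chain [set x].
  by apply/is_chainP => u v /set1P-> /set1P->; exact: comparablexx.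
have [A fA /fintype.subsetP/(_ x)/(_ (set11 x)) xA] := flag_exists c1.
pose C := [set z in A | z < x].
have cC : is_chain C.
  apply/is_chainP => u v; rewrite !inE => /andP[uA _] /andP[vA _].
  exact: (flag_chain fA).
have -> : r x = #|C|.
  rewrite -(card_in_imset (rank_ord_inj cC)) -[LHS](card_lt_ord rd).
  congr #|pred_of_set _|; apply/setP => k; rewrite inE.
  apply/idP/imsetP => [kx|[z]].
    have [|z zA rz] := @flag_rank A k fA; first by rewrite -ltnS.
    exists z; last exact: val_inj.
    rewrite inE zA; apply: comparable_rank_lt; last by rewrite rz.
    exact: (flag_chain fA).
  by rewrite inE => /andP[_ zx] -> /=; exact: r_lt.
apply: (@leq_bigmax_cond _ _ (fun C : {set Q} => #|C|)); rewrite cC /=.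
by apply/forall_inP => z; rewrite inE => /andP[].
Qed.

(** Adjacency inside the open interval from [x] to [y]. Connectedness of these intervals, assumed
    below for rank difference at least 3, is the local condition from which strong
    flag-connectedness is derived. *)
Definition proper_comparable (x y : Q) : rel Q :=
  [rel a b | [&& x < a < y, x < b < y & a >=< b]].

Hypothesis r_conn : forall x y, x < y -> ((r x).+2 < r y)%N ->
  forall z w, x < z < y -> x < w < y -> connect (proper_comparable x y) z w.

Definition extends (C : {set Q}) z := (z \notin C) && [forall w in C, z >=< w].

Definition comparable_extends (C : {set Q}) : rel Q :=
  [rel a b | [&& extends C a, extends C b & a >=< b]].

(** If [z] and [w] are incomparable, no element of [C] separates them, so both lie in the same gap
    of [C]. A long gap is connected by hypothesis. In a gap of rank difference 2, the bound on
    [#|C|] leaves room for an element in another gap, which is comparable with both. *)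
Lemma extends_connect (C : {set Q}) z w : is_chain C -> (#|C| <= d)%N ->
  \bot \in C -> \top \in C ->
  extends C z -> extends C w -> connect (comparable_extends C) z w.
Proof.
move=> chC cardC bC tC ez ew.
have [zw|nzw] := boolP (z >=< w); first by apply: connect1; apply/and3P.
have [/andP[zC /forall_inP cz] /andP[wC /forall_inP cw]] := (ez, ew).
have side u : u \in C -> (u < z) && (u < w) || (z < u) && (w < u).
  move=> uC; have := cz _ uC; have := cw _ uC.
  case: comparableP => //= [wu|uw|wu]; last by rewrite wu uC in wC.
    case: comparableP => //= [uz|zu]; last by rewrite zu uC in zC.
    by move: nzw; rewrite /Order.comparable (ltW (lt_trans wu uz)) orbT.
  case: comparableP => //= [zu|zu]; last by rewrite zu uC in zC.
  by move: nzw; rewrite /Order.comparable (ltW (lt_trans zu uw)).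
have bz : (\bot \in C) && (\bot < z).
  by rewrite bC; have := side _ bC; case/orP => /andP[] // /lt_geF; rewrite le0x.
have tz : (\top \in C) && (z < \top).
  by rewrite tC; have := side _ tC; case/orP => /andP[] // /lt_geF; rewrite lex1.
case: (@arg_maxnP _ \bot [pred u | (u \in C) && (u < z)] r bz) => x.
case: (@arg_minnP _ \top [pred u | (u \in C) && (z < u)] r tz) => y.
move=> /= /andP[yC zy] my /andP[xC xz] mx.
have xw : x < w by have := side _ xC; rewrite xz (lt_gtF xz) orbF.
have wy : w < y by have := side _ yC; rewrite zy (lt_gtF zy).
have [rxz rzy] := (r_lt xz, r_lt zy).
have [rxy|rxy] := ltnP (r x).+2 (r y).
  have ext a : x < a < y -> extends C a.
    move=> /andP[xa ay]; have [rxa ray] := (r_lt xa, r_lt ay).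
    apply/andP; split.
      apply/negP => aC; have /orP[/andP[az _]|/andP[za _]] := side _ aC.
        by have := mx a; rewrite aC az => /(_ isT); rewrite leqNgt rxa.
      by have := my a; rewrite aC za => /(_ isT); rewrite leqNgt ray.
    apply/forall_inP => u uC; have /is_chainP cC := chC.
    have /orP[/andP[uz _]|/andP[zu _]] := side _ uC.
      have := mx u; rewrite uC uz => /(_ isT) rux.
      have ux := comparable_rank_le (cC _ _ uC xC) rux.
      by rewrite /Order.comparable (le_trans ux (ltW xa)) orbT.
    have := my u; rewrite uC zu => /(_ isT) rux.
    have yu := comparable_rank_le (cC _ _ yC uC) rux.
    by rewrite /Order.comparable (le_trans (ltW ay) yu).
  have := r_conn (lt_trans xz zy) rxy (z := z) (w := w).
  rewrite xz zy xw wy => /(_ isT isT); apply: connect_sub => a b.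
  by move=> /and3P[ha hb ab]; apply: connect1; apply/and3P; split; rewrite ?ext.
(* Here the gap has room for a single rank, already taken by [z]. A flag through [z |: C] has a
   further element [u]; lying in another gap, it is comparable with [w] as well. *)
have chz : is_chain (z |: C) by apply: chainU1 => // u /cz.
have [A fA CA] := flag_exists chz.
have : ~~ (A \subset z |: C).
  apply/negP => /subset_leq_card; by rewrite (flag_card fA) cardsU1 zC leqNgt !ltnS cardC.
case/subsetPn => u uA; rewrite !inE negb_or => /andP[uz uC].
have cu v : v \in z |: C -> u >=< v.
  by move=> vC; apply: (flag_chain fA) => //; exact: (fintype.subsetP CA).
have czu : u >=< z by apply: cu; rewrite setU11.
have eu : extends C u.
  by rewrite /extends uC; apply/forall_inP => v vC; apply: cu; rewrite setU1r.
have cuw : u >=< w.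
  have := cu x; rewrite setU1r // => /(_ isT).
  case: comparableP => // [ux|xu|ux] _; last by rewrite ux xC in uC.
    by rewrite /Order.comparable (ltW (lt_trans ux xw)).
  have := cu y; rewrite setU1r // => /(_ isT).
  case: comparableP => // [uy|yu|uy] _; last by rewrite uy yC in uC.
    have [rxu ruy] := (r_lt xu, r_lt uy).
    case/eqP: uz; apply: comparable_rank_inj => //.
    by move: rxy rxz rzy rxu ruy; clear; lia.
  by rewrite /Order.comparable (ltW (lt_trans wy yu)) orbT.
apply: (connect_trans (y := u)); apply: connect1; apply/and3P; split=> //.
by rewrite comparable_sym.
Qed.

Definition flag_step (C : {set Q}) : rel {set Q} :=
  [rel X Y | [&& adjacent_flags X Y, C \subset X & C \subset Y]].

(** Induction on the number of elements that [C] lacks. Along a path of one-element extensions of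
    [C], two consecutive ones lie in a common flag, and flags sharing a larger chain are connected
    by induction. *)
Lemma flag_connect (C A B : {set Q}) : is_chain C -> is_flag A -> is_flag B ->
  C \subset A -> C \subset B -> connect (flag_step C) A B.
Proof.
have [n] := ubnP (d.+2 - #|C|); elim: n C A B => // n IH C A B hn chC fA fB CA CB.
wlog /andP[bC tC] : C hn chC CA CB / (\bot \in C) && (\top \in C).
  move=> wl; have [|bt] := boolP ((\bot \in C) && (\top \in C)); first exact: wl.
  have sub (D : {set Q}) : is_flag D -> C \subset D -> \bot |: (\top |: C) \subset D.
    by move=> fD CD; rewrite !finset.subUset !finset.sub1set flag_bot ?flag_top.
  have lt_card : (#|C| < #|\bot |: (\top |: C)|)%N.
    apply/proper_card; rewrite properE; apply/andP; split.
      by apply/fintype.subsetP => x xC; rewrite !inE xC !orbT.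
    apply: contra bt => /fintype.subsetP h.
    by rewrite !h // !inE eqxx ?orbT.
  have le_card : (#|\bot |: (\top |: C)| <= d.+2)%N.
    by rewrite -(flag_card fA) subset_leq_card ?sub.
  have : connect (flag_step (\bot |: (\top |: C))) A B.
    apply: IH; rewrite ?sub //.
      have ltC := leq_trans lt_card le_card.
      by rewrite -ltnS; apply: leq_trans hn; rewrite ltnS ltn_sub2l.
    apply/is_chainP => x y /(fintype.subsetP (sub _ fA CA)) xA.
    by move=> /(fintype.subsetP (sub _ fA CA)) yA; exact: (flag_chain fA).
  have sC : C \subset \bot |: (\top |: C).
    by apply/fintype.subsetP => x xC; rewrite !inE xC !orbT.
  apply: connect_sub => X Y /and3P[XY sX sY]; apply: connect1.
  by apply/and3P; split; rewrite ?(fintype.subset_trans sC).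
(* With at least [d.+1] of the [d.+2] elements prescribed, distinct flags differ in exactly one
   element and are adjacent. *)
have [cardC|cardC] := leqP #|C| d; last first.
  have [->|nAB] := eqVneq A B; first exact: connect0.
  apply: connect1; apply/and3P; split; rewrite // /adjacent_flags fA fB.
  have card_diff (X Y : {set Q}) : is_flag X -> is_flag Y -> X != Y ->
    C \subset X -> C \subset Y -> #|X :\: Y| = 1%N.
    move=> fX fY nXY CX CY; apply/eqP; rewrite eqn_leq; apply/andP; split.
      have : X :\: Y \subset X :\: C by exact: finset.setDS.
      move=> /subset_leq_card; rewrite [#|X :\: C|]cardsD (finset.setIidPr CX) (flag_card fX).
      by move=> le_diff; apply: leq_trans le_diff _; rewrite leq_subLR addn1 ltnS.
    rewrite card_gt0 finset.setD_eq0; apply: contra nXY => XY.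
    by rewrite eqEcard XY (flag_card fX) (flag_card fY) leqnn.
  by rewrite !card_diff // eq_sym.
have pick D : is_flag D -> C \subset D -> exists2 z, z \in D & extends C z.
  move=> fD CD; have : ~~ (D \subset C).
    apply/negP => /subset_leq_card.
    by rewrite (flag_card fD) leqNgt ltnS (leq_trans cardC).
  case/subsetPn => z zD zC; exists z => //; rewrite /extends zC.
  by apply/forall_inP => w wC; apply: (flag_chain fD) => //; exact: (fintype.subsetP CD).
have chU z : extends C z -> is_chain (z |: C).
  by move=> /andP[_ /forall_inP h]; exact: chainU1.
have step z (X Y : {set Q}) : extends C z -> is_flag X -> is_flag Y ->
    z |: C \subset X -> z |: C \subset Y -> connect (flag_step C) X Y.
  move=> ez fX fY zX zY.
  have : connect (flag_step (z |: C)) X Y.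
    apply: IH; rewrite ?chU // cardsU1; case/andP: ez => -> _.
    by move: hn cardC; clear; lia.
  apply: connect_sub => S T /and3P[ST hS hT]; apply: connect1.
  have sC : C \subset z |: C by exact: finset.subsetUr.
  by apply/and3P; split; rewrite ?(fintype.subset_trans sC).
have [[z zA ez] [w wB ew]] := (pick _ fA CA, pick _ fB CB).
have /connectP[p] := extends_connect chC cardC bC tC ez ew.
elim: p z A zA ez fA CA => [|u p IHp] z A zA ez fA CA /=.
  by move=> _ wz; apply: (step w) => //; rewrite finset.subUset finset.sub1set ?wB // wz zA.
move=> /andP[/and3P[_ eu zu] pp] lw.
have chzu : is_chain (u |: (z |: C)).
  apply: chainU1; first exact: chU.
  move=> v /setU1P[->|vC]; first by rewrite comparable_sym.
  by case/andP: eu => _ /forall_inP; apply.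
have [D fD] := flag_exists chzu; rewrite !finset.subUset !finset.sub1set => /and3P[uD zD CD].
apply: (connect_trans (y := D)).
  by apply: (step z) => //; rewrite finset.subUset finset.sub1set ?zA ?zD.
exact: IHp pp lw.
Qed.

Lemma graded_abstract_polytope :
  (forall x y, x < y -> r y = (r x).+2 -> #|[pred z : Q | x < z < y]| = 2%N) ->
  abstract_polytope d Q.
Proof.
move=> diamond; split; first exact: flag_card.
- move=> A B fA fB; apply: flag_connect; rewrite ?subsetIl ?subsetIr //.
  apply/is_chainP => x y /setIP[xA _] /setIP[yA _]; exact: (flag_chain fA).
- by move=> x y xy; rewrite !height_rank; exact: diamond.
Qed.

End GradedPoset.

Local Open Scope ring_scope.

(** * Simplicial polytopes *)

Section Dot.
Variables (R : realType) (d : nat).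
Implicit Types (x y : 'rV[R]_d) (c : 'cV[R]_d).

Definition dot x c : R := (x *m c) 0 0.

Lemma dotDl x y c : dot (x + y) c = dot x c + dot y c.
Proof. by rewrite /dot mulmxDl mxE. Qed.
Lemma dotZl a x c : dot (a *: x) c = a * dot x c.
Proof. by rewrite /dot -scalemxAl mxE. Qed.
Lemma dotNl x c : dot (- x) c = - dot x c.
Proof. by rewrite /dot mulNmx mxE. Qed.
Lemma dot_suml (J : finType) (P : pred J) (f : J -> 'rV[R]_d) c :
  dot (\sum_(j | P j) f j) c = \sum_(j | P j) dot (f j) c.
Proof. by rewrite /dot mulmx_suml summxE. Qed.
Lemma dot0l c : dot 0 c = 0.
Proof. by rewrite /dot mul0mx mxE. Qed.
Lemma dotDr x c1 c2 : dot x (c1 + c2) = dot x c1 + dot x c2.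
Proof. by rewrite /dot mulmxDr mxE. Qed.
Lemma dotNr x c : dot x (- c) = - dot x c.
Proof. by rewrite /dot mulmxN mxE. Qed.
Lemma dotBr x c1 c2 : dot x (c1 - c2) = dot x c1 - dot x c2.
Proof. by rewrite dotDr dotNr. Qed.
Lemma dotZr x a c : dot x (a *: c) = a * dot x c.
Proof. by rewrite /dot -scalemxAr mxE. Qed.
Lemma dot0r x : dot x 0 = 0.
Proof. by rewrite /dot mulmx0 mxE. Qed.
Lemma dot_sumr (J : finType) (P : pred J) x (f : J -> 'cV[R]_d) :
  dot x (\sum_(j | P j) f j) = \sum_(j | P j) dot x (f j).
Proof. by rewrite /dot mulmx_sumr summxE. Qed.

End Dot.

Section Conv.
Variables (R : realType) (m : nat) (I : finType) (u : I -> 'rV[R]_m).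
Implicit Types S T : {set I}.

Definition conv_set S : set 'rV[R]_m :=
  [set x | exists w : I -> R, [/\ forall i, i \in S -> 0 <= w i,
     \sum_(i in S) w i = 1 & x = \sum_(i in S) w i *: u i]]%classic.

Definition rows_of S : 'M[R]_(#|S|, m) := \matrix_(k < #|S|) u (enum_val k).

Lemma conv_rows_of S : conv_rows (rows_of S) = conv_set S.
Proof.
rewrite eqEsubset; split=> x.
  move=> [w [w0 w1] <-].
  (* At most one term is nonzero, since [enum_val] is injective; the sum serves as an inverse of the
     enumeration that is defined on all of [I]. *)
  pose w' i := \sum_(k < #|S|) (if enum_val k == i then w 0 k else 0).
  have w'E k : w' (enum_val k) = w 0 k.
    rewrite /w' (bigD1 k) //= eqxx big1 ?addr0 // => l lk.
    by rewrite (inj_eq enum_val_inj) (negbTE lk).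
  exists w'; split.
  - by move=> i _; apply: sumr_ge0 => k _; case: ifP.
  - by rewrite -w1 [LHS]big_enum_val /=; under eq_bigr do rewrite w'E.
  - rewrite mulmx_sum_row [RHS]big_enum_val /=; apply: eq_bigr => k _.
    by rewrite w'E rowK.
move=> [w [w0 w1 ->]]; exists (\row_k w (enum_val k)); first split.
- by move=> k; rewrite mxE w0 // enum_valP.
- by rewrite -w1 [RHS]big_enum_val /=; apply: eq_bigr => k _; rewrite mxE.
- rewrite mulmx_sum_row [RHS]big_enum_val /=; apply: eq_bigr => k _.
  by rewrite mxE rowK.
Qed.

Lemma conv_set_vertex S i : i \in S -> conv_set S (u i).
Proof.
move=> iS; exists (fun j => (j == i)%:R); split=> [j _||]; first by case: (j == i).
  rewrite (bigD1 i) //= eqxx big1 ?addr0 // => j /andP[_ /negbTE->] //.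
rewrite (bigD1 i) //= eqxx scale1r big1 ?addr0 // => j /andP[_ /negbTE->].
by rewrite scale0r.
Qed.

Lemma conv_setS S T : S \subset T -> (conv_set S `<=` conv_set T)%classic.
Proof.
move=> /fintype.subsetP ST x [w [w0 w1 ->]].
pose w' i := if i \in S then w i else 0.
exists w'; split=> [i _||].
- by rewrite /w'; case: ifP => // /w0.
- rewrite -w1 (big_setID S) /= [X in _ + X]big1 ?addr0.
    rewrite (finset.setIidPr _); last exact/fintype.subsetP.
    by apply: eq_bigr => i iS; rewrite /w' iS.
  by move=> i /setDP[_ /negbTE iS]; rewrite /w' iS.
- rewrite [RHS](big_setID S) /= [X in _ + X]big1 ?addr0.
    rewrite (finset.setIidPr _); last exact/fintype.subsetP.
    by apply: eq_bigr => i iS; rewrite /w' iS.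
  by move=> i /setDP[_ /negbTE iS]; rewrite /w' iS scale0r.
Qed.

Lemma conv_set_dot_le S c b : (forall i, i \in S -> dot (u i) c <= b) ->
  forall x, conv_set S x -> dot x c <= b.
Proof.
move=> cb x [w [w0 w1 ->]]; rewrite dot_suml -[leRHS]mul1r -w1 mulr_suml.
by apply: ler_sum => i iS; rewrite dotZl ler_wpM2l ?w0 ?cb.
Qed.

(** At a tight point the nonnegative numbers [w i * (b - dot (u i) c)] sum to zero, so only tight
    vertices carry weight. *)
Lemma conv_set_tight S c b : (forall i, i \in S -> dot (u i) c <= b) ->
  ([set x | conv_set S x /\ dot x c = b] =
   conv_set [set i in S | dot (u i) c == b])%classic.
Proof.
move=> cb; rewrite eqEsubset; split=> x.
  move=> [[w [w0 w1 ->]] tight].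
  have w_tight i : i \in S -> w i * (b - dot (u i) c) = 0.
    move: i; apply/psumr_eq0P => [i iS|]; first by rewrite mulr_ge0 ?w0 ?subr_ge0 ?cb.
    under eq_bigr do rewrite mulrBr.
    rewrite sumrB -mulr_suml w1 mul1r -[X in X - _]tight dot_suml.
    by apply/eqP; rewrite subr_eq0; apply/eqP/eq_bigr => i _; rewrite dotZl.
  have w_out i : i \in S -> dot (u i) c != b -> w i = 0.
    move=> iS nb; have /eqP := w_tight i iS.
    by rewrite mulf_eq0 subr_eq0 [b == _]eq_sym (negbTE nb) orbF => /eqP.
  have restr (V : nmodType) (f : I -> V) : (forall i, w i = 0 -> f i = 0) ->
      \sum_(i in S) f i = \sum_(i in [set i in S | dot (u i) c == b]) f i.
    move=> f0; rewrite (bigID (fun i => dot (u i) c == b)) /= [X in _ + X]big1 ?addr0.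
      by apply: eq_bigl => i; rewrite inE.
    by move=> i /andP[iS nb]; apply: f0; exact: w_out.
  exists w; split.
  - by move=> i /setIdP[/w0].
  - by rewrite -restr.
  - by rewrite restr // => i ->; rewrite scale0r.
move=> xT; split; first by apply: conv_setS xT; apply/fintype.subsetP => i /setIdP[].
case: xT => w [w0 w1 ->]; rewrite dot_suml -[RHS]mul1r -w1 mulr_suml.
by apply: eq_bigr => i /setIdP[_ /eqP <-]; rewrite dotZl.
Qed.

Lemma is_face_conv_set S F : is_face (conv_set S) F <->
  exists c b, (forall i, i \in S -> dot (u i) c <= b) /\
    F = conv_set [set i in S | dot (u i) c == b].
Proof.
split=> [[c [b [cb ->]]]|[c [b [cb ->]]]]; exists c, b; split.
- by move=> i iS; apply: cb; exact: conv_set_vertex.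
- by apply: conv_set_tight => i iS; apply: cb; exact: conv_set_vertex.
- exact: conv_set_dot_le.
- by rewrite -conv_set_tight.
Qed.

End Conv.

Definition facet_basis (R : realType) d (I : finType) (v : I -> 'rV[R]_d)
    (F : {set I}) (e : I -> 'cV[R]_d) : Prop :=
  [/\ forall y, y = \sum_(i in F) dot y (e i) *: v i,
      {in F &, forall i j, dot (v j) (e i) = (i == j)%:R}
    & forall j, j \notin F -> \sum_(i in F) dot (v j) (e i) < 1].

(* The points [v i] span a polytope with the origin in its interior whose facets
   are the simplices on the members of [K]; the functionals of a facet basis sum
   to the one defining the facet. *)
Definition simplicial_polytope (R : realType) d (I : finType)
    (v : I -> 'rV[R]_d) (K : {set {set I}}) : Prop :=
  [/\ forall F, F \in K -> #|F| = d,
      forall F, F \in K -> exists e, facet_basis v F e,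
      forall F i, F \in K -> i \in F ->
        exists2 j, j \notin F & j |: F :\ i \in K,
      forall F, F \in K -> F != finset.setT
    & K != finset.set0].

Lemma facet_bases (R : realType) d (I : finType) (v : I -> 'rV[R]_d)
    (K : {set {set I}}) : simplicial_polytope v K ->
  exists e, forall F, F \in K -> facet_basis v F (e F).
Proof.
move=> [_ h _ _ _]; have /choice[e he] F : exists e, F \in K -> facet_basis v F e.
  by have [/h[e He]|FK] := boolP (F \in K); [exists e | exists (fun=> 0)].
by exists e.
Qed.

Section Simplicial.
Variables (R : realType) (d : nat) (I : finType) (v : I -> 'rV[R]_d).
Variables (K : {set {set I}}) (e : {set I} -> I -> 'cV[R]_d).
Hypothesis K_poly : simplicial_polytope v K.
Hypothesis e_basis : forall F, F \in K -> facet_basis v F (e F).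
Implicit Types (F G S : {set I}) (y : 'rV[R]_d).

Lemma facet_card F : F \in K -> #|F| = d.
Proof. by case: K_poly => + _ _ _ _; apply. Qed.

Lemma facet_neighbour F i : F \in K -> i \in F ->
  exists2 j, j \notin F & j |: F :\ i \in K.
Proof. by case: K_poly => _ _ + _ _; apply. Qed.

Lemma facet_proper F : F \in K -> F != finset.setT.
Proof. by case: K_poly => _ _ _ + _; apply. Qed.

Lemma facet_avoids_vertex F : F \in K -> exists i, i \notin F.
Proof.
move=> FK; apply/existsP; rewrite -negb_forall.
apply: contraNN (facet_proper FK) => /forallP h.
by apply/eqP/setP => i; rewrite h inE.
Qed.

Lemma facet_exists : exists F, F \in K.
Proof. by case: K_poly => _ _ _ _ /finset.set0Pn. Qed.

Lemma facet_sub_eq F G : F \in K -> G \in K -> F \subset G -> F = G.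
Proof.
by move=> FK GK FG; apply/eqP; rewrite eqEcard FG !facet_card //=.
Qed.

Lemma facet_expand F y : F \in K -> y = \sum_(i in F) dot y (e F i) *: v i.
Proof. by case/e_basis => + _ _; apply. Qed.

Lemma facet_dual F i j : F \in K -> i \in F -> j \in F ->
  dot (v j) (e F i) = (i == j)%:R.
Proof. by move=> /e_basis[_ + _]; apply. Qed.

Definition level F : 'cV[R]_d := \sum_(i in F) e F i.

Lemma levelE F y : dot y (level F) = \sum_(i in F) dot y (e F i).
Proof. exact: dot_sumr. Qed.

Lemma level_in F j : F \in K -> j \in F -> dot (v j) (level F) = 1.
Proof.
move=> FK jF; rewrite levelE (bigD1 j) //= facet_dual // eqxx big1 ?addr0 //.
by move=> i /andP[iF /negbTE ij]; rewrite facet_dual // ij.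
Qed.

Lemma level_out F j : F \in K -> j \notin F -> dot (v j) (level F) < 1.
Proof. by move=> /e_basis[_ _ + jF]; rewrite levelE; apply. Qed.

Lemma level_le1 F j : F \in K -> dot (v j) (level F) <= 1.
Proof.
move=> FK; have [jF|jF] := boolP (j \in F); first by rewrite level_in.
by rewrite ltW ?level_out.
Qed.

Lemma level_eq1 F j : F \in K -> (dot (v j) (level F) == 1) = (j \in F).
Proof.
move=> FK; have [jF|jF] := boolP (j \in F); first by rewrite level_in ?eqxx.
by rewrite lt_eqF ?level_out.
Qed.

Lemma dot_comb S (w : I -> R) c :
  dot (\sum_(i in S) w i *: v i) c = \sum_(i in S) w i * dot (v i) c.
Proof. by rewrite dot_suml; apply: eq_bigr => i _; rewrite dotZl. Qed.

Lemma dot_expand F y c : F \in K ->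
  dot y c = \sum_(i in F) dot y (e F i) * dot (v i) c.
Proof. by move=> FK; rewrite {1}(facet_expand y FK) dot_comb. Qed.

Lemma dot_comb_dual F S (w : I -> R) i : F \in K -> S \subset F -> i \in F ->
  dot (\sum_(k in S) w k *: v k) (e F i) = if i \in S then w i else 0.
Proof.
move=> FK /fintype.subsetP SF iF; rewrite dot_comb.
have [iS|iS] := boolP (i \in S); last first.
  rewrite big1 // => k kS; rewrite (facet_dual FK iF (SF _ kS)).
  by case: eqP iS => [->|_ _]; [rewrite kS | rewrite mulr0].
rewrite (bigD1 i) //= facet_dual // eqxx mulr1 big1 ?addr0 // => k.
by move=> /andP[/SF kF /negbTE ki]; rewrite facet_dual // eq_sym ki mulr0.
Qed.

(** The levels of [F] and of its neighbour agree on the ridge [F :\ i]. They differ only through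
    [v i], which lies strictly below the neighbour, and this is where [y] has a negative
    coordinate. *)
Lemma pivot F i y : F \in K -> i \in F -> dot y (e F i) < 0 ->
  exists G, [/\ G \in K, F :\ i \subset G & dot y (level F) < dot y (level G)].
Proof.
move=> FK iF yi; have [j jF GK] := facet_neighbour FK iF.
exists (j |: F :\ i); split=> //; first exact: finset.subsetUr.
set G := _ |: _ in GK *; rewrite levelE (dot_expand y (level G) FK) -subr_gt0 -sumrB.
have iG : i \notin G.
  by rewrite !inE eqxx orbF; apply: contraNneq jF => <-.
rewrite (bigD1 i) //= big1 ?addr0 => [|k /andP[kF ki]].
  have := level_out GK iG; rewrite -{2}[dot y (e F i)]mulr1 -mulrBr => h.
  by rewrite nmulr_rgt0 // subr_lt0.
by rewrite level_in ?mulr1 ?subrr // !inE ki kF orbT.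
Qed.

Lemma pivot_ind y (P : {set I} -> Prop) :
  (forall F, F \in K ->
     (forall G, G \in K -> dot y (level F) < dot y (level G) -> P G) -> P F) ->
  forall F, F \in K -> P F.
Proof.
move=> IH F; have [n] := ubnP #|[set G in K | dot y (level F) < dot y (level G)]|.
elim: n F => // n IHn F hn FK; apply: IH => // G GK FG; apply: IHn => //.
rewrite -ltnS; apply: leq_trans hn; rewrite ltnS; apply/proper_card.
rewrite properE; apply/andP; split.
  by apply/fintype.subsetP => H; rewrite !inE => /andP[-> /(lt_trans FG)].
by apply/subsetPn; exists G; rewrite !inE GK ?FG // ltxx.
Qed.

Lemma fan_complete y :
  exists2 F, F \in K & forall i, i \in F -> 0 <= dot y (e F i).
Proof.
have [F0 F0K] := facet_exists; move: F0 F0K; apply: pivot_ind => F FK IH.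
have [h|] := boolP [forall i in F, 0 <= dot y (e F i)].
  by exists F => // i iF; move/forall_inP: h; apply.
rewrite negb_forall_in => /exists_inP[i iF]; rewrite -ltNge => yi.
by have [G [GK _]] := pivot FK iF yi; exact: IH.
Qed.

(** Evaluate both levels at [y]. Its coordinates on [F] are nonnegative and no vertex exceeds level
    1, so the level of [F] is at least that of [G], which is the sum of the weights. A vertex of [S]
    off [F] would make the level of [F] strictly smaller than this sum. *)
Lemma cone_sub F G S (w : I -> R) : F \in K -> G \in K -> S \subset G ->
  (forall i, i \in S -> 0 < w i) ->
  (forall i, i \in F -> 0 <= dot (\sum_(k in S) w k *: v k) (e F i)) ->
  S \subset F.
Proof.
set y := \sum_(k in S) _ => FK GK /fintype.subsetP SG w0 y0.
apply/fintype.subsetP => j jS; apply: contraT => jF.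
have : dot y (level G) <= dot y (level F).
  rewrite (dot_expand y (level G) FK) levelE; apply: ler_sum => i iF.
  by rewrite -[leRHS]mulr1 ler_wpM2l ?y0 ?level_le1.
have -> : dot y (level G) = \sum_(k in S) w k.
  by rewrite dot_comb; apply: eq_bigr => k kS; rewrite level_in ?SG ?mulr1.
rewrite dot_comb leNgt (bigD1 j) //= [ltRHS](bigD1 j) //= ltr_leD //.
  by rewrite -[ltRHS]mulr1 ltr_pM2l ?w0 ?level_out.
apply: ler_sum => k /andP[kS _].
by rewrite -[leRHS]mulr1 ler_wpM2l ?level_le1 ?ltW ?w0.
Qed.

Definition ridge_adjacent S : rel {set I} :=
  [rel F G : {set I} | [&& F \in K, G \in K, S \subset F :&: G
                         & (d <= #|F :&: G|.+1)%N]].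

(** Pivot towards the sum of the vertices of [G :\: S], but only at vertices outside [S], so that
    [S] is never lost. When no such pivot remains, a large multiple of the vertices of [S] makes the
    other coordinates nonnegative too, and [cone_sub] identifies the facet reached with [G]. *)
Lemma link_connected S F G : F \in K -> G \in K -> S \subset F -> S \subset G ->
  connect (ridge_adjacent S) F G.
Proof.
move=> FK GK SF SG; pose y := \sum_(k in G :\: S) (1 : R) *: v k.
move: F FK SF; apply: (@pivot_ind y) => F FK IH SF.
have [h|] := boolP [forall i in F :\: S, 0 <= dot y (e F i)]; last first.
  rewrite negb_forall_in => /exists_inP[i /setDP[iF iS]]; rewrite -ltNge => yi.
  have [H [HK FH lt_level]] := pivot FK iF yi.
  have SH : S \subset H.
    apply: fintype.subset_trans FH; apply/fintype.subsetP => k kS.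
    by rewrite !inE (fintype.subsetP SF) // andbT; apply: contraNneq iS => <-.
  apply: connect_trans (IH H HK lt_level SH); apply: connect1.
  apply/and4P; split=> //; first by rewrite finset.subsetI SF.
  have : F :\ i \subset F :&: H by rewrite finset.subsetI FH subD1set.
  by move/subset_leq_card; rewrite -ltnS; apply: leq_trans;
     rewrite -(facet_card FK) (cardsD1 i F) iF.
suff GF : G \subset F by rewrite (facet_sub_eq GK FK GF) connect0.
(* [M] exceeds the absolute value of every coordinate of [y] on [F]. *)
pose M := 1 + \sum_(k in F) `|dot y (e F k)|.
have M0 : 0 < M by rewrite ltr_pwDl ?ltr01 // sumr_ge0.
pose w k := if k \in S then M else 1.
have yM : \sum_(k in G) w k *: v k = \sum_(k in S) M *: v k + y.
  rewrite (big_setID S) /= (finset.setIidPr SG); congr (_ + _).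
    by apply: eq_bigr => k kS; rewrite /w kS.
  by apply: eq_bigr => k /setDP[_ /negbTE kS]; rewrite /w kS.
apply: (cone_sub FK GK (w := w)) => // [k _|i iF]; first by rewrite /w; case: ifP.
rewrite yM dotDl dot_comb_dual //; case: ifPn => iS; last first.
  by rewrite add0r; move/forall_inP: h; apply; rewrite !inE iS.
rewrite -lerBlDr sub0r /M (bigD1 i) //= addrA ler_wpDr ?sumr_ge0 //.
by rewrite ler_wpDl // -normrN ler_norm.
Qed.

(** Levels of facets through the ridge form a pencil [level F - t * e F i], with [t > 0] for facets
    avoiding [i]. For two such facets [G] and [H], the new vertex of each lies below the other; the
    first inequality forces the parameter of [H] to be smaller than that of [G], the second forces
    the opposite. *)
Lemma card_facets_ridge F i : F \in K -> i \in F ->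
  #|[set G in K | F :\ i \subset G]| = 2%N.
Proof.
move=> FK iF; have [j jF GK] := facet_neighbour FK iF.
set G := j |: _ in GK; have iG : i \notin G.
  by rewrite !inE eqxx orbF; apply: contraNneq jF => <-.
have FG : F != G by apply: contraNneq iG => <-.
suff -> : [set G in K | F :\ i \subset G] = [set F; G] by rewrite cards2 FG.
apply/setP => H; rewrite !inE; apply/andP/orP => [[HK FH]|[]/eqP->]; last 2 first.
- by split=> //; exact: subD1set.
- by split=> //; exact: finset.subsetUr.
have [iH|iH] := boolP (i \in H).
  left; rewrite eq_sym; apply/eqP/facet_sub_eq => //; apply/fintype.subsetP => k kF.
  have [->//|ki] := eqVneq k i.
  by apply: (fintype.subsetP FH); rewrite !inE ki.
right; have [jH|jH] := boolP (j \in H).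
  rewrite eq_sym; apply/eqP/facet_sub_eq => //.
  by rewrite /G finset.subUset finset.sub1set jH.
have [k kH kF] : exists2 k, k \in H & k \notin F.
  apply/subsetPn; apply: contraNN iH => HF.
  by rewrite (facet_sub_eq HK FK HF).
have kG : k \notin G.
  rewrite !inE negb_or (negbTE kF) andbF andbT; apply: contraNneq jH => <-//.
pose t (X : {set I}) := 1 - dot (v i) (level X).
have levelF X y : X \in K -> F :\ i \subset X ->
    dot y (level X) = dot y (level F) - t X * dot y (e F i).
  move=> XK FX; rewrite [dot y (level F)]levelE (dot_expand y (level X) FK).
  rewrite (bigD1 i) //= [in RHS](bigD1 i) //=.
  have -> : \sum_(l in F | l != i) dot y (e F l) * dot (v l) (level X) =
            \sum_(l in F | l != i) dot y (e F l).
    apply: eq_bigr => l /andP[lF li]; rewrite level_in ?mulr1 //.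
    by apply: (fintype.subsetP FX); rewrite !inE li.
  by rewrite /t; ring.
have FGs : F :\ i \subset G by exact: finset.subsetUr.
have jG : j \in G by rewrite !inE eqxx.
have := level_in GK jG; have := level_out HK jH; have := level_out FK jF.
have := level_in HK kH; have := level_out GK kG; have := level_out FK kF.
have : 0 < t G by rewrite subr_gt0 level_out.
have : 0 < t H by rewrite subr_gt0 level_out.
rewrite !(levelF G) // !(levelF H) //.
move: (t G) (t H) (dot (v j) (level F)) (dot (v k) (level F)).
move: (dot (v j) (e F i)) (dot (v k) (e F i)) => a b p q x z.
move=> q0 p0 z1 h1 h2 x1 h3 h4; exfalso.
have a0 : a < 0.
  by rewrite -(pmulr_rlt0 _ p0); lra.
have b0 : b < 0.
  by rewrite -(pmulr_rlt0 _ q0); lra.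
nra.
Qed.

End Simplicial.

(** * The face lattice *)

Section FacePoset.
Variables (I : finType) (K : {set {set I}}).

(** The empty set and the whole vertex set are listed explicitly, so that bottom and top exist for
    an arbitrary [K] and the order structure can be declared before any geometry. *)
Definition is_face_set (S : {set I}) : bool :=
  [|| S == finset.set0, S == finset.setT | [exists F in K, S \subset F]].

Record faces : Type := Faces {
  face_verts :> {set I};
  _ : is_face_set face_verts }.

HB.instance Definition _ := [isSub for face_verts].
HB.instance Definition _ := [Finite of faces by <:].

Definition faces_le (x y : faces) : bool := (x : {set I}) \subset y.

Lemma faces_le_refl : reflexive faces_le.
Proof. by move=> x; exact: fintype.subxx. Qed.
Lemma faces_le_anti : antisymmetric faces_le.
Proof. by move=> x y xy; apply/val_inj/eqP; rewrite finset.eqEsubset. Qed.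
Lemma faces_le_trans : transitive faces_le.
Proof. by move=> y x z; exact: fintype.subset_trans. Qed.

HB.instance Definition _ := Order.Le_isPOrder.Build set_display faces
  faces_le_refl faces_le_anti faces_le_trans.

Lemma is_face_set0 : is_face_set finset.set0.
Proof. by rewrite /is_face_set eqxx. Qed.
Lemma is_face_setT : is_face_set finset.setT.
Proof. by rewrite /is_face_set eqxx orbT. Qed.

Lemma faces_le0x (x : faces) : (Faces is_face_set0 <= x)%O.
Proof. exact: finset.sub0set. Qed.
Lemma faces_lex1 (x : faces) : (x <= Faces is_face_setT)%O.
Proof. exact: finset.subsetT. Qed.

HB.instance Definition _ := Order.hasBottom.Build set_display faces faces_le0x.
HB.instance Definition _ := Order.hasTop.Build set_display faces faces_lex1.

Lemma faces_leE (x y : faces) : (x <= y)%O = ((x : {set I}) \subset y).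
Proof. by []. Qed.

Lemma faces_ltE (x y : faces) : (x < y)%O = ((x : {set I}) \proper y).
Proof. by rewrite Order.POrderTheory.lt_leAnge properE. Qed.

Lemma faces_topE (x : faces) : (x == \top%O) = ((x : {set I}) == finset.setT).
Proof. by []. Qed.

End FacePoset.

Section SimplicialPoset.
Variables (R : realType) (d : nat) (I : finType) (v : I -> 'rV[R]_d).
Variables (K : {set {set I}}) (e : {set I} -> I -> 'cV[R]_d).
Hypothesis K_poly : simplicial_polytope v K.
Hypothesis e_basis : forall F, F \in K -> facet_basis v F (e F).
Local Notation Q := (faces K).

Lemma face_sub_facet (S : {set I}) : is_face_set K S -> S != finset.setT ->
  exists2 F, F \in K & S \subset F.
Proof.
move=> /or3P[/eqP->|/eqP->|/exists_inP[F FK SF]]; rewrite ?eqxx //.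
- by have [F FK] := facet_exists K_poly; exists F; rewrite ?finset.sub0set.
- by exists F.
Qed.

Lemma sub_facet_face (S F : {set I}) : F \in K -> S \subset F -> is_face_set K S.
Proof. by move=> FK SF; apply/or3P/Or33/exists_inP; exists F. Qed.

Lemma sub_facet_proper (S F : {set I}) : F \in K -> S \subset F ->
  S != finset.setT.
Proof.
move=> FK SF; apply: contraNneq (facet_proper K_poly FK) => ST.
by rewrite -finset.subTset -ST.
Qed.

Lemma face_sub (S : {set I}) (x : Q) : (x : {set I}) != finset.setT ->
  S \subset x -> is_face_set K S.
Proof.
move=> xT Sx; have [F FK xF] := face_sub_facet (valP x) xT.
exact: sub_facet_face FK (fintype.subset_trans Sx xF).
Qed.

Lemma face_card (x : Q) : (x : {set I}) != finset.setT -> (#|face_verts x| <= d)%N.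
Proof.
move=> xT; have [F FK xF] := face_sub_facet (valP x) xT.
by rewrite -(facet_card K_poly FK) subset_leq_card.
Qed.

Definition facet_face (F : {set I}) (FK : F \in K) : Q :=
  Faces (sub_facet_face FK (fintype.subxx F)).

(** The whole polytope is represented by all its vertices, whose number says nothing about its rank;
    hence the separate value [d.+1]. *)
Definition face_rank (x : Q) : nat :=
  if (x : {set I}) == finset.setT then d.+1 else #|face_verts x|.

Lemma face_rank_lt x y : (x < y)%O -> (face_rank x < face_rank y)%N.
Proof.
rewrite faces_ltE => xy; have xT : (x : {set I}) != finset.setT.
  by apply: contraTneq xy => ->; rewrite properE finset.subsetT andbF.
rewrite /face_rank (negbTE xT); case: ifP => _; last exact: proper_card.
by rewrite ltnS face_card.
Qed.

Lemma setU1_between (x y : {set I}) i : x \proper y -> i \in y -> i \notin x ->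
  (#|x|.+1 < #|y|)%N -> (x \proper i |: x) && (i |: x \proper y).
Proof.
move=> xy iy ix xy2; rewrite !properEcard finset.subsetUr cardsU1 ix ltnSn /= xy2.
by rewrite finset.subUset finset.sub1set iy proper_sub.
Qed.

Lemma face_rank_gap x y : (x < y)%O -> ((face_rank x).+1 < face_rank y)%N ->
  exists z : Q, (x < z < y)%O.
Proof.
move=> lt_xy; have := lt_xy; rewrite faces_ltE => xy.
have xT : (x : {set I}) != finset.setT.
  by apply: contraTneq xy => ->; rewrite properE finset.subsetT andbF.
rewrite /face_rank (negbTE xT); case: ifPn => yT rxy.
  have [F FK xF] := face_sub_facet (valP x) xT; exists (facet_face FK).
  rewrite !faces_ltE /= (eqP yT) finset.properT (facet_proper K_poly FK) andbT.
  by rewrite properEcard xF (facet_card K_poly FK).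
have /properP[_ [i iy ix]] := xy.
have /andP[xz zy] := setU1_between xy iy ix rxy.
exists (Faces (face_sub yT (proper_sub zy))).
by rewrite !faces_ltE /= xz.
Qed.

(** Below the top, climb to facets and follow a path through ridges; the intersection of consecutive
    facets is strictly larger than [x] by the rank assumption, so it is a valid intermediate face.
    Below a proper face the interval is Boolean: descend to [i |: x] and [j |: x] and join them
    through [i |: (j |: x)]. *)
Lemma face_conn (x y : Q) : (x < y)%O -> ((face_rank x).+2 < face_rank y)%N ->
  forall z w : Q, (x < z < y)%O -> (x < w < y)%O ->
  connect (proper_comparable x y) z w.
Proof.
move=> lt_xy rxy z w xzy xwy.
have link (a b : Q) : (x < a < y)%O -> (x < b < y)%O -> (a <= b)%O ->
    connect (proper_comparable x y) a b /\ connect (proper_comparable x y) b a.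
  move=> ha hb ab; split; apply: connect1; apply/and3P; split=> //;
  by rewrite /Order.comparable ab ?orbT.
move: rxy; have := lt_xy; rewrite faces_ltE => xy.
have xT : (x : {set I}) != finset.setT.
  by apply: contraTneq xy => ->; rewrite properE finset.subsetT andbF.
rewrite /face_rank (negbTE xT); case: ifPn => yT rxy.
  have below (u : Q) : (x < u < y)%O -> exists F (FK : F \in K),
      (x < facet_face FK < y)%O /\ (u <= facet_face FK)%O.
    move=> /andP[xu]; rewrite faces_ltE (eqP yT) finset.properT => uT.
    have [F FK uF] := face_sub_facet (valP u) uT; exists F, FK.
    rewrite faces_leE; split=> //; rewrite [X in _ && X]faces_ltE (eqP yT).
    rewrite finset.properT (facet_proper K_poly FK) andbT.
    exact: Order.POrderTheory.lt_le_trans xu _.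
  have [[F [FK [xF zF]]] [G [GK [xG wG]]]] := (below z xzy, below w xwy).
  apply: (connect_trans (proj1 (link z (facet_face FK) xzy xF zF))).
  apply: connect_trans (proj2 (link w (facet_face GK) xwy xG wG)).
  have subF H (HK : H \in K) : (x < facet_face HK < y)%O -> (x : {set I}) \subset H.
    by move=> /andP[]; rewrite faces_ltE => /proper_sub.
  have /connectP[p] := link_connected K_poly e_basis FK GK (subF _ _ xF) (subF _ _ xG).
  elim: p F FK xF {zF} => [|H p IH] F FK xF /=.
    move=> _ GF; move: GK xG {wG}; rewrite GF => GK xG.
    by rewrite (_ : facet_face FK = facet_face GK) ?connect0 //; exact: val_inj.
  move=> /andP[/and4P[_ HK xFH dFH] pp] lG.
  have xH : (x < facet_face HK < y)%O.
    rewrite !faces_ltE /= (eqP yT) finset.properT (facet_proper K_poly HK) andbT.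
    rewrite properEcard (facet_card K_poly HK); move: xFH.
    by rewrite finset.subsetI => /andP[_ ->] /=; rewrite -ltnS ltnW // ltnW.
  apply: (connect_trans _ (IH H HK xH pp lG)).
  have FHF : F :&: H \subset F by exact: finset.subsetIl.
  pose u : Q := Faces (sub_facet_face FK FHF).
  have xu : (x < u < y)%O.
    rewrite !faces_ltE /= (eqP yT) finset.properT (sub_facet_proper FK FHF) andbT.
    by rewrite properEcard xFH -ltnS; apply: leq_trans dFH; rewrite -ltnS.
  apply: (connect_trans (y := u)).
    exact: (proj2 (link u (facet_face FK) xu xF FHF)).
  by apply: (proj1 (link u (facet_face HK) xu xH _)); exact: finset.subsetIr.
have atom (u : Q) : (x < u < y)%O ->
    exists i (h : is_face_set K (i |: x)),
    [/\ (i \in (y : {set I})), (x < Faces h < y)%O & (Faces h <= u)%O].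
  move=> /andP[]; rewrite !faces_ltE => xu uy.
  have /properP[_ [i iu ix]] := xu; have iy := fintype.subsetP (proper_sub uy) _ iu.
  have /andP[xz zy] := setU1_between xy iy ix (ltnW rxy).
  exists i, (face_sub yT (proper_sub zy)); split=> //; first by rewrite !faces_ltE /= xz.
  by rewrite faces_leE /= finset.subUset finset.sub1set iu proper_sub.
have [[i [hi [iy xi iz]]] [j [hj [jy xj jw]]]] := (atom z xzy, atom w xwy).
have ijy : i |: (j |: x) \proper y.
  rewrite properEcard !finset.subUset !finset.sub1set iy jy (proper_sub xy) /=.
  apply: leq_ltn_trans rxy; rewrite !cardsU1.
  by case: (i \notin _); case: (j \notin _); clear; lia.
pose u : Q := Faces (face_sub yT (proper_sub ijy)).
have xiu : (Faces hi <= u)%O by rewrite faces_leE /= finset.setUS // finset.subsetUr.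
have xju : (Faces hj <= u)%O by rewrite faces_leE /= finset.subsetUr.
have xu : (x < u < y)%O.
  rewrite [X in _ && X]faces_ltE ijy andbT.
  by case/andP: xi => /Order.POrderTheory.lt_le_trans -> //.
apply: (connect_trans (proj2 (link _ _ xi xzy iz))).
apply: (connect_trans (proj1 (link _ _ xi xu xiu))).
apply: (connect_trans (proj2 (link _ _ xj xu xju))).
exact: (proj1 (link _ _ xj xwy jw)).
Qed.

(** Under the top, [x] is a ridge and [card_facets_ridge] applies; under a proper face, the two
    intermediate faces add one of the two elements of [y :\: x]. *)
Lemma face_diamond (x y : Q) : (x < y)%O ->
  face_rank y = (face_rank x).+2 -> #|[pred z : Q | (x < z < y)%O]| = 2%N.
Proof.
rewrite faces_ltE => xy; have xT : (x : {set I}) != finset.setT.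
  by apply: contraTneq xy => ->; rewrite properE finset.subsetT andbF.
rewrite /face_rank (negbTE xT) -(card_imset _ val_inj).
case: ifPn => yT rxy.
  have [F FK xF] := face_sub_facet (valP x) xT.
  have : (#|F :\: x| = 1)%N.
    rewrite cardsD (finset.setIidPr xF) (facet_card K_poly FK).
    by move/succn_inj: rxy => ->; rewrite subSn ?subnn.
  move=> /eqP/cards1P[i Fi].
  have iF : i \in F by have /setDP[] : i \in F :\: x by rewrite Fi set11.
  have xE : F :\ i = x :> {set I}.
    apply/setP => k; have /setP/(_ k) := Fi; have := fintype.subsetP xF k.
    by rewrite !inE; case: (k \in x); case: (k \in F); case: (k == i) => //= /(_ isT).
  rewrite -[RHS](card_facets_ridge K_poly e_basis FK iF).
  apply: eq_card => G; rewrite inE xE; apply/imsetP/andP => [[z]|[GK xG]].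
    rewrite inE !faces_ltE (eqP yT) finset.properT => /andP[xz zT] ->.
    have [H HK zH] := face_sub_facet (valP z) zT.
    suff -> : val z = H by rewrite HK (fintype.subset_trans (proper_sub xz)).
    apply/eqP; rewrite eqEcard zH (facet_card K_poly HK).
    by rewrite -ltnS rxy; exact: proper_card xz.
  exists (facet_face GK) => //; rewrite inE !faces_ltE /= (eqP yT) finset.properT.
  rewrite (facet_proper K_poly GK) andbT properEcard xG (facet_card K_poly GK).
  by rewrite -ltnS rxy leqnn.
have xsy := proper_sub xy.
have yx2 : (#|(y : {set I}) :\: x| = 2)%N.
  by rewrite cardsD (finset.setIidPr xsy) rxy -addn2 addKn.
rewrite -[RHS]yx2 -(card_in_imset (f := fun i => i |: x)); last first.
  move=> i j /setDP[_ ix] /setDP[_ jx] /setP/(_ i).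
  by rewrite !inE eqxx (negbTE ix) !orbF => /esym/eqP.
apply: eq_card => S; apply/imsetP/imsetP => [[z]|[i /setDP[iy ix] ->]].
  rewrite inE !faces_ltE => /andP[xz zy] ->.
  have [zsx xz1] : x \subset z /\ #|z :\: x| = 1%N.
    split; first exact: proper_sub.
    have := proper_card zy; have := proper_card xz.
    rewrite cardsD (finset.setIidPr (proper_sub xz)) rxy.
    by rewrite !ltnS => xz2 zx2; apply/eqP; rewrite eqn_leq leq_subLR subn_gt0 addn1 zx2.
  have /eqP/cards1P[i zi] := xz1; exists i.
    have : i \in z :\: x by rewrite zi set11.
    by rewrite !inE => /andP[-> /(fintype.subsetP (proper_sub zy))].
  by rewrite -zi finset.setUC -{1}(finset.setIidPr zsx) finset.setID.
have /andP[xz zy] := setU1_between xy iy ix (eq_leq (esym rxy)).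
by exists (Faces (face_sub yT (proper_sub zy))); rewrite // inE !faces_ltE xz.
Qed.

Lemma faces_abstract_polytope : abstract_polytope d Q.
Proof.
apply: (graded_abstract_polytope (r := face_rank)).
- exact: face_rank_lt.
- exact: face_rank_gap.
- rewrite /face_rank /=; case: eqP => [T0|]; last by rewrite finset.cards0.
  have [F FK] := facet_exists K_poly; have := facet_proper K_poly FK.
  by rewrite -finset.subTset -T0 finset.sub0set.
- by rewrite /face_rank eqxx.
- exact: face_conn.
- exact: face_diamond.
Qed.

End SimplicialPoset.

(** * Faces of the convex hull and of its facets *)

Section SimplicialConv.
Variables (R : realType) (d : nat) (I : finType) (v : I -> 'rV[R]_d).
Variables (K : {set {set I}}) (e : {set I} -> I -> 'cV[R]_d).
Hypothesis K_poly : simplicial_polytope v K.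
Hypothesis e_basis : forall F, F \in K -> facet_basis v F (e F).
Implicit Types (F G S T : {set I}) (x y : 'rV[R]_d).
Local Notation level := (level e).

(** This expresses that the origin is an interior point. If [b <= 0], the functional is nonpositive
    on the cones over the facets, hence everywhere, and a linear functional of constant sign
    vanishes. *)
Lemma valid_bound_gt0 c b : (forall i, dot (v i) c <= b) ->
  0 < b \/ [/\ b = 0 & forall i, dot (v i) c = 0].
Proof.
move=> cb; have [b0|b0] := ltP 0 b; [by left|right].
have c0 i : dot (v i) c <= 0 := le_trans (cb i) b0.
have dot_le0 y : dot y c <= 0.
  have [F FK y0] := fan_complete K_poly e_basis y.
  rewrite (dot_expand e_basis y c FK); apply: sumr_le0 => i iF.
  by rewrite mulr_ge0_le0 ?y0.
have dot0 i : dot (v i) c = 0.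
  by apply/eqP; rewrite eq_le c0 /= -oppr_le0 -dotNl dot_le0.
split=> //; apply/eqP; rewrite eq_le b0 /=.
have [F FK] := facet_exists K_poly.
by have [i _] := facet_avoids_vertex K_poly FK; rewrite -(dot0 i) cb.
Qed.

(** For [b > 0], the sum of the tight vertices lies in the cone over some facet [F], on which [c] is
    at most [b * level F]. Comparing the two at this sum, a tight vertex off [F] would give a strict
    inequality the wrong way. *)
Lemma tight_is_face_set c b : (forall i, dot (v i) c <= b) ->
  is_face_set K [set i | dot (v i) c == b].
Proof.
move=> cb; have [b0|[b0 c0]] := valid_bound_gt0 cb; last first.
  rewrite (_ : [set i | _] = finset.setT) ?is_face_setT //.
  by apply/setP => i; rewrite !inE c0 b0 eqxx.
set S := [set i | _]; pose y := \sum_(i in S) (1 : R) *: v i.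
have [F FK y0] := fan_complete K_poly e_basis y.
apply: (sub_facet_face FK); apply/fintype.subsetP => j jS; apply: contraT => jF.
have : dot y c <= b * dot y (level F).
  rewrite (dot_expand e_basis y c FK) levelE mulr_sumr.
  by apply: ler_sum => i iF; rewrite mulrC ler_wpM2r ?y0.
have -> : dot y c = b * \sum_(i in S) 1.
  rewrite dot_comb mulr_sumr; apply: eq_bigr => i.
  by rewrite inE mul1r mulr1 => /eqP.
rewrite ler_pM2l // dot_comb leNgt (bigD1 j) //= [ltRHS](bigD1 j) //=.
rewrite ltr_leD ?mul1r ?(level_out e_basis) //.
by apply: ler_sum => i _; rewrite mul1r (level_le1 e_basis).
Qed.

(** Add up the levels of all facets containing [S]: tightness means lying in each of them. A vertex
    [i] of one such facet outside [S] is exchanged by the neighbour across [F :\ i], which still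
    contains [S]. *)
Lemma face_set_tight S : is_face_set K S ->
  exists c b, (forall i, dot (v i) c <= b) /\ [set i | dot (v i) c == b] = S.
Proof.
move=> fS; have [->|ST] := eqVneq S finset.setT.
  exists 0, 0; split=> [i|]; first by rewrite dot0r.
  by apply/setP => i; rewrite !inE dot0r eqxx.
have [F FK SF] := face_sub_facet K_poly fS ST.
pose P := [set G in K | S \subset G].
exists (\sum_(G in P) level G), (\sum_(G in P) 1).
have leP i G : G \in P -> dot (v i) (level G) <= 1.
  by rewrite inE => /andP[GK _]; rewrite (level_le1 e_basis).
split=> [i|]; first by rewrite dot_sumr; apply: ler_sum => G; exact: leP.
apply/setP => i; rewrite inE dot_sumr; apply/eqP/idP => [sum_eq|iS]; last first.
  apply: eq_bigr => G; rewrite inE => /andP[GK SG].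
  by rewrite (level_in e_basis) ?(fintype.subsetP SG).
have tight G : G \in P -> i \in G.
  move=> GP; have GK : G \in K by case/setIdP: GP.
  rewrite -(level_eq1 e_basis i GK) eq_sym -subr_eq0; apply/eqP; move: G GP {GK}.
  apply/psumr_eq0P => [G GP|]; first by rewrite subr_ge0 leP.
  by rewrite sumrB sum_eq subrr.
have iF : i \in F by apply: tight; rewrite inE FK.
apply: contraT => iS; have [j jF GK] := facet_neighbour K_poly FK iF.
have : i \in j |: F :\ i.
  apply: tight; rewrite inE GK; apply/fintype.subsetP => k kS.
  by rewrite !inE (fintype.subsetP SF) // andbT; apply/orP; right; apply: contraNneq iS => <-.
by rewrite !inE eqxx orbF => /eqP ij; rewrite -ij iF in jF.
Qed.

Local Notation P := (conv_set v finset.setT).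
Local Notation tight c b := [set i in finset.setT | dot (v i) c == b].

Lemma tight_setT c b : tight c b = [set i | dot (v i) c == b].
Proof. by apply/setP => i; rewrite !inE. Qed.

Lemma is_face_conv S : is_face_set K S -> is_face P (conv_set v S).
Proof.
move=> /face_set_tight[c [b [cb <-]]]; apply/is_face_conv_set.
by exists c, b; split=> //; rewrite tight_setT.
Qed.

Lemma is_face_conv_inv X : is_face P X ->
  exists2 S, is_face_set K S & X = conv_set v S.
Proof.
move=> /is_face_conv_set[c [b [cb ->]]]; exists (tight c b) => //.
by rewrite tight_setT; apply: tight_is_face_set => i; apply: cb; rewrite inE.
Qed.

Lemma conv_set_sub S T : is_face_set K T ->
  (conv_set v S `<=` conv_set v T)%classic -> S \subset T.
Proof.
move=> /face_set_tight[c [b [cb <-]]] ST; apply/fintype.subsetP => i iS.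
rewrite inE; have [w [w0 w1 ->]] := ST _ (conv_set_vertex v iS).
rewrite dot_comb -[eqbRHS]mul1r -w1 mulr_suml; apply/eqP/eq_bigr => j.
by rewrite inE => /eqP->.
Qed.

Definition face_of_faces (x : faces K) : face_lattice P :=
  FaceOf (introT (asboolP _) (is_face_conv (valP x))).

Lemma face_lattice_iso : order_iso (faces K) (face_lattice P).
Proof.
have mono_f : {mono face_of_faces : x y / (x <= y)%O}.
  move=> x y; apply/idP/idP => [le_xy|xy].
    by apply: (conv_set_sub (valP y)); move: le_xy; rewrite -subsetEset.
  have : (conv_set v x `<=` conv_set v y)%classic by exact: conv_setS.
  by rewrite -subsetEset.
exists face_of_faces => //.
have inj_f : injective face_of_faces.
  by move=> x y fxy; apply/eqP; rewrite Order.POrderTheory.eq_le -!mono_f fxy lexx.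
have surj_f (X : face_lattice P) : exists x : faces K, face_of_faces x = X.
  have /asboolP/is_face_conv_inv[S fS XS] := valP X.
  by exists (Faces fS); apply: val_inj; rewrite /= -XS.
have [g gK] := choice surj_f; exists g => // x; exact: inj_f.
Qed.

(** An affine relation [(a, c)] among the coordinate columns makes the functional [c] equal to [- a]
    on all vertices, hence to [- a] times the level of any facet. A vertex off that facet, at level
    below 1, forces [a = 0], and then [c = 0]. *)
Lemma simplicial_convex_polytope : convex_polytope d.+1 P.
Proof.
exists #|(finset.setT : {set I})|, (rows_of v finset.setT).
rewrite conv_rows_of; split=> //; apply/eqP.
rewrite /affine_rank -mxrank_tr -[_ == _]/(row_free _).
apply: inj_row_free => u; rewrite -(hsubmxK u); move: (lsubmx u) (rsubmx u) => a c.
rewrite tr_row_mx mul_row_col => uV.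
have vc i : dot (v i) c^T = - a 0 0.
  apply/eqP; rewrite -addr_eq0 addrC; apply/eqP.
  have iT : i \in (finset.setT : {set I}) by rewrite inE.
  have := congr1 (fun M : 'rV_#|(finset.setT : {set I})| => M 0 (enum_rank_in iT i)) uV.
  rewrite !mxE big_ord1 !mxE mulr1 => <-; congr (_ + _).
  by rewrite /dot !mxE; apply: eq_bigr => k _; rewrite !mxE enum_rankK_in // mulrC.
have cE y F : F \in K -> dot y c^T = - a 0 0 * dot y (level F).
  move=> FK; rewrite (dot_expand e_basis y _ FK) levelE mulr_sumr.
  by apply: eq_bigr => i _; rewrite vc mulrC.
have [F FK] := facet_exists K_poly.
have [j jF] := facet_avoids_vertex K_poly FK.
have a0 : a 0 0 = 0.
  have := cE (v j) F FK; have := level_out e_basis FK jF; rewrite vc.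
  move: (a 0 0) (dot _ _) => s t t1 /eqP; rewrite -subr_eq0 -{1}[- s]mulr1 -mulrBr.
  by rewrite mulf_eq0 oppr_eq0 subr_eq0 [1 == t]eq_sym (lt_eqF t1) orbF => /eqP.
have c0 : c = 0.
  apply/rowP => k; have := cE (delta_mx 0 k) F FK.
  by rewrite a0 oppr0 mul0r /dot -rowE !mxE.
have -> : a = 0 by apply/rowP => k; rewrite !ord1 a0 mxE.
by rewrite c0 row_mx0.
Qed.

Lemma is_face_facet F X : F \in K -> is_face (conv_set v F) X <->
  exists2 S : {set I}, S \subset F & X = conv_set v S.
Proof.
move=> FK; split=> [/is_face_conv_set[c [b [_ ->]]]|[S SF ->]].
  by exists [set i in F | dot (v i) c == b] => //; apply/fintype.subsetP => i /setIdP[].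
(* This functional is 0 on the vertices of [S] and -1 on the other vertices of the simplex, so it
   exposes exactly [S]. *)
pose c := - \sum_(i in F :\: S) e F i.
have cE i : i \in F -> dot (v i) c = - (i \notin S)%:R.
  move=> iF; rewrite dotNr dot_sumr; congr (- _).
  have dual k : k \in F :\: S -> dot (v i) (e F k) = (k == i)%:R.
    by move=> /setDP[kF _]; rewrite (facet_dual e_basis FK).
  rewrite (eq_bigr _ dual); have [iS|iS] /= := boolP (i \in S).
    by rewrite big1 // => k /setDP[_ kS]; case: eqP kS => // ->; rewrite iS.
  rewrite (bigD1 i) /= ?inE ?iS // eqxx big1 ?addr0 // => k.
  by move=> /andP[_ /negbTE->].
apply/is_face_conv_set; exists c, 0; split=> [i iF|].
  by rewrite cE // oppr_le0 ler0n.
congr conv_set; apply/setP => i; rewrite inE.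
have [iF|iF] := boolP (i \in F); last by apply: contraNF iF => /(fintype.subsetP SF).
by rewrite cE // oppr_eq0 pnatr_eq0 eqb0 negbK.
Qed.

Lemma facet_convex_polytope F : F \in K -> convex_polytope d (conv_set v F).
Proof.
move=> FK; exists #|F|, (rows_of v F); rewrite conv_rows_of; split=> //.
rewrite /affine_rank -[RHS](facet_card K_poly FK); apply/eqP.
rewrite -[_ == _]/(row_free _); apply: inj_row_free => w.
rewrite mul_mx_row -row_mx0 => /eq_row_mx[_ wV]; apply/rowP => k; rewrite mxE.
have /(congr1 (fun y => dot y (e F (enum_val k)))) := wV.
rewrite mulmx_sum_row dot_suml dot0l => <-.
rewrite (bigD1 k) //= big1 ?addr0 => [|l lk]; rewrite dotZl rowK.
  by rewrite (facet_dual e_basis FK) ?enum_valP // eqxx mulr1.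
rewrite (facet_dual e_basis FK) ?enum_valP // (inj_eq enum_val_inj) eq_sym.
by rewrite (negbTE lk) mulr0.
Qed.

End SimplicialConv.

(** * Radial projection *)

Section RadialProjection.
Variables (R : realType) (d : nat).
Implicit Types x y : 'rV[R]_d.

Definition sqnorm x : R := \sum_i x 0 i ^+ 2.
Definition radial x : 'rV[R]_d := (Num.sqrt (sqnorm x))^-1 *: x.

Lemma sqnorm_gt0 x : x != 0 -> 0 < sqnorm x.
Proof.
move=> x0; rewrite lt_def sumr_ge0 ?andbT => [|i _]; last exact: sqr_ge0.
apply: contraNneq x0 => /psumr_eq0P h; apply/eqP/rowP => i.
have /eqP := h (fun j _ => sqr_ge0 (x 0 j)) i isT.
by rewrite sqrf_eq0 mxE => /eqP.
Qed.

Lemma sqnormZ a x : sqnorm (a *: x) = a ^+ 2 * sqnorm x.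
Proof. by rewrite mulr_sumr; apply: eq_bigr => i _; rewrite mxE exprMn. Qed.

Lemma radial_sphere x : x != 0 -> unit_sphere (radial x).
Proof.
move=> /sqnorm_gt0 x0; rewrite /unit_sphere /= -/(sqnorm _) sqnormZ exprVn.
by rewrite sqr_sqrtr ?ltW // mulVf // gt_eqF.
Qed.

Lemma radial_scale x : x != 0 -> exists2 t, 0 < t & radial x = t *: x.
Proof.
move=> /sqnorm_gt0 x0; exists (Num.sqrt (sqnorm x))^-1 => //.
by rewrite invr_gt0 sqrtr_gt0.
Qed.

Lemma radialZ a y : 0 < a -> unit_sphere y -> radial (a *: y) = y.
Proof.
move=> a0; rewrite /unit_sphere /= -/(sqnorm _) => y1.
rewrite /radial sqnormZ y1 mulr1 sqrtr_sqr gtr0_norm // scalerA mulVf ?gt_eqF //.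
by rewrite scale1r.
Qed.

Lemma continuous_dot (c : 'cV[R]_d) : continuous (fun x => dot x c).
Proof.
have -> : (fun x => dot x c) = (fun x => \sum_k x 0 k * c k 0).
  by apply/funext => x; rewrite /dot mxE.
move=> x; apply: cvg_big => [||k _]; first exact: add_continuous.
  exact: nbhs_filter.
by apply: cvgM; [exact: nbhs_filter|exact: coord_continuous|apply: cvg_cst; exact: nbhs_filter].
Qed.

Lemma continuous_sqnorm : continuous sqnorm.
Proof.
move=> x; apply: cvg_big => [||k _]; first exact: add_continuous.
  exact: nbhs_filter.
by apply: cvgM; [exact: nbhs_filter|exact: coord_continuous|exact: coord_continuous].
Qed.

Lemma continuous_radial x : x != 0 -> {for x, continuous radial}.
Proof.
move=> /sqnorm_gt0 x0.
have sqrt_cvg :=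
  continuous_comp (@continuous_sqnorm x) (@sqrt_continuous R (sqnorm x)).
have inv_cvg := cvgV (lt0r_neq0 (etrans (sqrtr_gt0 _) x0)) sqrt_cvg.
exact: cvgZ (inv_cvg (nbhs_filter x)) cvg_id.
Qed.

End RadialProjection.

(** * The tessellation of the sphere by projected facets *)

Section Spherical.
Variables (R : realType) (d : nat) (I : finType) (v : I -> 'rV[R]_d).
Variables (K : {set {set I}}) (e : {set I} -> I -> 'cV[R]_d).
Hypothesis K_poly : simplicial_polytope v K.
Hypothesis e_basis : forall F, F \in K -> facet_basis v F (e F).
Implicit Types (F G S T : {set I}) (x y : 'rV[R]_d).
Local Notation level := (level e).
Local Notation spread S := (@radial R d @` conv_set v S)%classic.

Lemma conv_facet_level F x : F \in K -> conv_set v F x -> dot x (level F) = 1.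
Proof.
move=> FK [w [_ w1 ->]]; rewrite dot_comb -[RHS]w1; apply: eq_bigr => i iF.
by rewrite (level_in e_basis) ?mulr1.
Qed.

Lemma conv_facet_neq0 F S x : F \in K -> S \subset F -> conv_set v S x -> x != 0.
Proof.
move=> FK SF /(conv_setS SF)/(conv_facet_level FK); apply: contra_eq_neq => ->.
by rewrite dot0l eq_sym oner_eq0.
Qed.

Lemma conv_set_neq0 S x : conv_set v S x -> exists i, i \in S.
Proof.
move=> [w [_ w1 _]]; apply/finset.set0Pn; apply/eqP => S0.
by move/eqP: w1; rewrite S0 big_set0 eq_sym oner_eq0.
Qed.

(** The points [x] and [y] are positive multiples of each other. The vertices carrying [x] with
    positive weight therefore lie in [G] by [cone_sub], and comparing coordinates in the dual basis
    of [G] puts them in [T]. *)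
Lemma radial_conv_meet F G S T x y : F \in K -> G \in K ->
  S \subset F -> T \subset G -> conv_set v S x -> conv_set v T y ->
  radial x = radial y -> conv_set v (S :&: T) x.
Proof.
move=> FK GK SF TG xS yT xy.
have [s s0 sx] := radial_scale (conv_facet_neq0 FK SF xS).
have [t t0 ty] := radial_scale (conv_facet_neq0 GK TG yT).
have {sx ty xy} xE : x = (s^-1 * t) *: y.
  by rewrite -scalerA -ty -xy sx scalerA mulVf ?scale1r // gt_eqF.
have r0 : 0 < s^-1 * t by rewrite mulr_gt0 ?invr_gt0.
case: yT => w' [w'0 _ yE]; case: xS => w [w0 w1 xS].
pose S0 := [set i in S | 0 < w i].
have S0S : S0 \subset S by apply/fintype.subsetP => i /setIdP[].
have restr (V : nmodType) (f : I -> V) : (forall i, w i = 0 -> f i = 0) ->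
    \sum_(i in S) f i = \sum_(i in S0) f i.
  move=> f0; rewrite (bigID (fun i => 0 < w i)) /= [X in _ + X]big1 ?addr0.
    by apply: eq_bigl => i; rewrite inE.
  move=> i /andP[iS]; rewrite -leNgt => wi; apply: f0; apply/eqP.
  by rewrite eq_le wi w0.
have xS0 : x = \sum_(i in S0) w i *: v i.
  by rewrite xS; apply: restr => i ->; rewrite scale0r.
have xG i : i \in G ->
    dot x (e G i) = s^-1 * t * (if i \in T then w' i else 0).
  by move=> iG; rewrite xE dotZl yE (dot_comb_dual e_basis).
have S0G : S0 \subset G.
  apply: (cone_sub e_basis GK FK (w := w)) => [|i /setIdP[]//|i iG].
    exact: fintype.subset_trans S0S SF.
  rewrite -xS0 xG // mulr_ge0 ?(ltW r0) //.
  by case: ifP => // iT; exact: w'0.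
have S0T : S0 \subset T.
  apply/fintype.subsetP => i iS0; have iG := fintype.subsetP S0G i iS0.
  have := xG i iG; rewrite xS0 (dot_comb_dual e_basis) // iS0.
  case: ifP => // _; rewrite mulr0 => wi; case/setIdP: iS0 => _.
  by rewrite wi ltxx.
apply: (@conv_setS _ _ _ _ S0); first by rewrite finset.subsetI S0S.
exists w; split=> // [i /setIdP[/w0]//|]; by rewrite -restr.
Qed.

Lemma spread_meet F G S T : F \in K -> G \in K -> S \subset F -> T \subset G ->
  (spread S `&` spread T = spread (S :&: T))%classic.
Proof.
move=> FK GK SF TG; rewrite eqEsubset; split=> z.
  move=> [[x xS <-] [y yT yx]]; exists x => //.
  exact: (radial_conv_meet FK GK SF TG xS yT (esym yx)).
move=> [x xST <-]; split; exists x => //; move: xST; apply: conv_setS.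
  exact: finset.subsetIl.
exact: finset.subsetIr.
Qed.

Lemma spread_sub F G S T : F \in K -> G \in K -> S \subset F -> T \subset G ->
  (spread S `<=` spread T)%classic <-> S \subset T.
Proof.
move=> FK GK SF TG; split=> [ST|ST _ [x xS <-]]; last first.
  by exists x => //; exact: conv_setS xS.
apply/fintype.subsetP => i iS.
have iF : [set i] \subset F by rewrite finset.sub1set (fintype.subsetP SF).
have ii : conv_set v [set i] (v i) by apply: conv_set_vertex; rewrite inE.
have [y yT yi] : spread T (radial (v i)).
  by apply: ST; exists (v i) => //; exact: conv_set_vertex.
have := radial_conv_meet FK GK iF TG ii yT (esym yi).
by move=> /conv_set_neq0[j]; rewrite !inE => /andP[/eqP->].
Qed.

Lemma spread_cover y : unit_sphere y -> exists2 F, F \in K & spread F y.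
Proof.
move=> y1; have [F FK y0] := fan_complete K_poly e_basis y; exists F => //.
pose a i := dot y (e F i); pose L := \sum_(i in F) a i.
have L0 : 0 < L.
  rewrite lt_def sumr_ge0 // andbT; apply/negP => /eqP/psumr_eq0P a0.
  have y_0 : y = 0.
    rewrite (facet_expand e_basis y FK) big1 // => i iF.
    by rewrite -/(a i) a0 ?scale0r // => j jF; exact: y0.
  move: y1; rewrite /unit_sphere /= y_0 big1 => [/eqP|i _].
    by rewrite eq_sym oner_eq0.
  by rewrite mxE expr0n.
exists (L^-1 *: y); last by rewrite radialZ ?invr_gt0.
exists (fun i => L^-1 * a i); split=> [i iF||].
- by rewrite mulr_ge0 ?invr_ge0 ?y0 // ltW.
- by rewrite -mulr_sumr mulVf // gt_eqF.
- rewrite {1}(facet_expand e_basis y FK) scaler_sumr.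
  by apply: eq_bigr => i _; rewrite scalerA.
Qed.

Lemma facet_homeo F : F \in K -> homeo_on (conv_set v F) (@radial R d).
Proof.
move=> FK; split.
  apply: continuous_in_subspaceT => x; rewrite inE => xF.
  exact/continuous_radial/(conv_facet_neq0 FK (fintype.subxx F) xF).
(* A facet lies in the hyperplane where its level is 1, so dividing by the level undoes the
   projection. *)
exists (fun y => (dot y (level F))^-1 *: y); split=> [x xF|].
  have [t t0 ->] := radial_scale (conv_facet_neq0 FK (fintype.subxx F) xF).
  rewrite dotZl (conv_facet_level FK xF) mulr1 scalerA mulVf ?scale1r //.
  by rewrite gt_eqF.
apply: continuous_in_subspaceT => y; rewrite inE => -[x xF <-].
have [t t0 xt] := radial_scale (conv_facet_neq0 FK (fintype.subxx F) xF).
have level_neq0 : dot (radial x) (level F) != 0.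
  by rewrite xt dotZl (conv_facet_level FK xF) mulr1 gt_eqF.
have inv_cvg := cvgV level_neq0 (@continuous_dot _ _ (level F) (radial x)).
exact: cvgZ (inv_cvg (nbhs_filter _)) cvg_id.
Qed.

Definition facet_tile F : set (set 'rV[R]_d) :=
  [set (@radial R d @` X)%classic | X in is_face (conv_set v F)]%classic.

Lemma facet_tileP F X : F \in K -> facet_tile F X <->
  exists2 S : {set I}, S \subset F & X = spread S.
Proof.
move=> FK; split=> [[Y /(is_face_facet e_basis _ FK)[S SF ->] <-]|[S SF ->]].
  by exists S.
by exists (conv_set v S) => //; apply/(is_face_facet e_basis _ FK); exists S.
Qed.

Lemma tile_facet F : F \in K -> tile (facet_tile F) = spread F.
Proof.
move=> FK; rewrite /tile eqEsubset; split=> [z [X]|z zF].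
  move=> /(facet_tileP _ FK)[S SF ->] [x xS <-]; exists x => //.
  exact: conv_setS xS.
by exists (spread F) => //; apply/(facet_tileP _ FK); exists F.
Qed.

Lemma faces_spherical : spherical R d (faces K).
Proof.
pose J := {F : {set I} | F \in K}.
exists J, (fun F : J => facet_tile (val F)), (fun x : faces K => spread x).
split.
- split.
  + move=> F; exists d, (conv_set v (val F)), (@radial R d); split=> //.
      exact: (facet_convex_polytope K_poly e_basis (valP F)).
    exact: facet_homeo (valP F).
  + rewrite eqEsubset; split=> [z [F _]|y /spread_cover[F FK yF]].
      rewrite (tile_facet (valP F)) => -[x xF <-]; apply: radial_sphere.
      exact: conv_facet_neq0 (valP F) (fintype.subxx _) xF.
    by exists (exist _ F FK) => //=; rewrite tile_facet.
  + move=> F G FG; have [FK GK] := (valP F, valP G).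
    rewrite !tile_facet // meetEset (spread_meet FK GK) ?fintype.subxx //.
    split; first by apply/(facet_tileP _ FK); exists (val F :&: val G);
      rewrite ?finset.subsetIl.
    move=> eqF; have FG' : val F \subset val F :&: val G.
      apply/(spread_sub FK GK (fintype.subxx _) (finset.subsetIr _ _)).
      by rewrite eqF.
    case/eqP: FG; apply: val_inj; apply: (facet_sub_eq K_poly FK GK).
    by move: FG'; rewrite finset.subsetI => /andP[].
  + move=> F G X; have [FK GK] := (valP F, valP G); rewrite !tile_facet //.
    rewrite (spread_meet FK GK) ?fintype.subxx // => XFG /(facet_tileP _ FK)[S SF XS].
    apply/(facet_tileP _ GK); exists S => //; move: XFG; rewrite XS.
    move/(spread_sub FK GK SF (finset.subsetIr _ _)).
    by rewrite finset.subsetI => /andP[].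
- rewrite eqEsubset; split=> [_ [x xT <-]|X [F _ /(facet_tileP _ (valP F))[S SF ->]]].
    have [F FK xF] := face_sub_facet K_poly (valP x) xT.
    by exists (exist _ F FK) => //; apply/(facet_tileP _ FK); exists (val x).
  exists (Faces (sub_facet_face (valP F) SF)) => //=.
  by rewrite faces_topE (sub_facet_proper K_poly (valP F) SF).
- move=> x y xT yT.
  have [F FK xF] := face_sub_facet K_poly (valP x) xT.
  have [G GK yG] := face_sub_facet K_poly (valP y) yT.
  by split=> /(spread_sub FK GK xF yG).
Qed.

End Spherical.

(** * Stacking *)

Lemma uniformly_small (R : realFieldType) (J : finType) (P : pred J) (a b : J -> R) :
  (forall j, P j -> 0 < a j) ->
  exists2 m, 0 < m & forall t, 0 < t < m -> forall j, P j -> t * b j < a j.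
Proof.
move=> a0; pose q j := a j / (1 + `|b j|).
have b1 j : 0 < 1 + `|b j| by rewrite ltr_wpDr.
(* The default 1 keeps the minimum positive when no index satisfies [P]; the summand 1 in the
   denominators plays the same part when [b j = 0]. *)
exists (\big[Order.min/1]_(j | P j) q j).
  by apply/bigmin_gtP; split=> // j Pj; rewrite divr_gt0 ?a0.
move=> t /andP[t0 /bigmin_gtP[_ tm]] j Pj; have tq := tm j Pj.
apply: (@le_lt_trans _ _ (t * (1 + `|b j|))); last by rewrite -ltr_pdivlMr.
by rewrite ler_wpM2l ?(ltW t0) // ler_wpDl ?ler_norm.
Qed.

Section StackComplex.
Variables (I : finType) (K T : {set {set I}}).
Implicit Types (F : {set I}).

Local Notation apex := {F : {set I} | F \in T}.

Definition stack_vertex := (I + apex)%type.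

Definition old_facet F : {set stack_vertex} := inl @: F.

Definition cap (F : apex) (i : I) : {set stack_vertex} :=
  inr F |: inl @: (val F :\ i).

(* A new vertex is placed beyond each facet in [T], which is thereby replaced by
   the cone over its boundary. *)
Definition stack : {set {set stack_vertex}} :=
  [set X | [exists F in K :\: T, X == old_facet F] ||
           [exists F : apex, exists i in val F, X == cap F i]].

Lemma stackP X : reflect
  ((exists2 F, F \in K :\: T & X = old_facet F) \/
   (exists F : apex, exists2 i, i \in val F & X = cap F i)) (X \in stack).
Proof.
rewrite inE; apply: (iffP orP) => -[].
- by move=> /exists_inP[F FK /eqP->]; left; exists F.
- by move=> /existsP[F /exists_inP[i iF /eqP->]]; right; exists F, i.
- by move=> [F FK ->]; left; apply/exists_inP; exists F.
- by move=> [F [i iF ->]]; right; apply/existsP; exists F; apply/exists_inP; exists i.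
Qed.

Lemma old_in_stack F : F \in K -> F \notin T -> old_facet F \in stack.
Proof. by move=> FK FT; apply/stackP; left; exists F; rewrite // inE FT. Qed.

Lemma cap_in_stack (F : apex) i : i \in val F -> cap F i \in stack.
Proof. by move=> iF; apply/stackP; right; exists F, i. Qed.

Lemma inl_inj : injective (@inl I apex).
Proof. by move=> i j []. Qed.

Lemma mem_old_inl F i : (inl i \in old_facet F) = (i \in F).
Proof. by rewrite mem_imset //; exact: inl_inj. Qed.

Lemma mem_old_inr F (G : apex) : (inr G \in old_facet F) = false.
Proof. by apply/negP => /imsetP[]. Qed.

Lemma mem_cap_inl (F : apex) i j : (inl j \in cap F i) = (j != i) && (j \in val F).
Proof. by rewrite in_setU1 mem_imset ?inE //; exact: inl_inj. Qed.

Lemma mem_cap_inr (F : apex) i (G : apex) : (inr G \in cap F i) = (G == F).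
Proof.
rewrite in_setU1 (_ : (inr G \in inl @: _) = false) ?orbF //.
by apply/negP => /imsetP[].
Qed.

Lemma card_old F : #|old_facet F| = #|F|.
Proof. by rewrite card_imset //; exact: inl_inj. Qed.

Lemma card_cap (F : apex) i : i \in val F -> #|cap F i| = #|val F|.
Proof.
move=> iF; rewrite cardsU1 card_imset; last exact: inl_inj.
rewrite (cardsD1 i (val F)) iF; congr (nat_of_bool _ + _)%N.
by apply/imsetP; case.
Qed.

Lemma big_old (V : nmodType) F (f : stack_vertex -> V) :
  \sum_(x in old_facet F) f x = \sum_(i in F) f (inl i).
Proof. by rewrite big_imset //= => i j _ _; exact: inl_inj. Qed.

Lemma big_cap (V : nmodType) (F : apex) i (f : stack_vertex -> V) :
  \sum_(x in cap F i) f x = f (inr F) + \sum_(j in val F :\ i) f (inl j).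
Proof.
rewrite big_setU1 /=; last by apply/imsetP; case.
by rewrite big_imset //= => j k _ _; exact: inl_inj.
Qed.

End StackComplex.

Section Stack.
Variables (R : realType) (d : nat) (I : finType) (v : I -> 'rV[R]_d).
Variables (K T : {set {set I}}).
Hypothesis K_poly : simplicial_polytope v K.
Hypothesis TK : T \subset K.
Hypothesis d_gt0 : (0 < d)%N.
Local Notation stk := (stack K T).

(** Across the ridge [F :\ i] one meets the old neighbour, or the apex of that neighbour if it has
    been stacked. The last clause says that this apex is not the one over [F] itself, which matters
    when the ridge is approached from a cap of [F]. *)
Lemma neighbour_in_stack F i : F \in K -> i \in F ->
  exists2 z, z \notin old_facet T F & z |: old_facet T (F :\ i) \in stk /\
    (forall G, z = inr G -> val G != F).
Proof.
move=> FK iF; have [j jF GK] := facet_neighbour K_poly FK iF.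
set G := j |: F :\ i in GK; have [GT|GT] := boolP (G \in T); last first.
  exists (inl j); first by rewrite mem_old_inl.
  split=> //; rewrite (_ : _ |: _ = old_facet T G) ?old_in_stack //.
  by rewrite /old_facet imsetU1.
exists (inr (exist _ G GT)); first by rewrite mem_old_inr.
split=> [|_ [<-]] /=; last first.
  by apply: contraNneq jF => <-; rewrite !inE eqxx.
rewrite (_ : _ |: _ = cap (exist _ G GT) j) ?cap_in_stack //= ?inE ?eqxx //.
rewrite /cap /= /old_facet (_ : G :\ j = F :\ i) //.
by apply/setP => k; rewrite !inE; case: eqVneq => //= ->; rewrite (negbTE jF) andbF.
Qed.

Lemma cap_old (F : {F : {set I} | F \in T}) i : cap F i :\ inr F = old_facet T (val F :\ i).
Proof.
apply/setP => -[k|G]; first by rewrite inE mem_cap_inl mem_old_inl !inE.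
rewrite in_setD1 mem_cap_inr mem_old_inr.
by apply/andP => -[/eqP nGF /eqP GF]; apply: nGF; rewrite GF.
Qed.

Lemma stack_neighbour X z : X \in stk -> z \in X ->
  exists2 z', z' \notin X & z' |: X :\ z \in stk.
Proof.
case/stackP => [[F /setDP[FK FT] ->]|[F [i iF ->]]].
  case: z => [i|G]; rewrite ?mem_old_inr // mem_old_inl => iF.
  have [z zF [zK _]] := neighbour_in_stack FK iF; exists z => //.
  suff -> : old_facet T F :\ inl i = old_facet T (F :\ i) by [].
  apply/setP => -[k|G]; first by rewrite in_setD1 !mem_old_inl !inE.
  by rewrite in_setD1 !mem_old_inr andbF.
have FK : val F \in K by exact: (fintype.subsetP TK) (valP F).
case: z => [j|G]; rewrite ?mem_cap_inl ?mem_cap_inr.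
  move=> /andP[ji jF]; exists (inl i); first by rewrite mem_cap_inl eqxx.
  rewrite (_ : _ |: _ = cap F j) ?cap_in_stack //.
  apply/setP => -[k|G].
    rewrite in_setU1 in_setD1 !mem_cap_inl.
    have [->|ki] := eqVneq k i; first by rewrite eqxx [i == j]eq_sym ji iF.
    by rewrite !(inj_eq (@inl_inj _ _)) (negbTE ki).
  by rewrite in_setU1 in_setD1 !mem_cap_inr.
move=> /eqP->; rewrite cap_old; have [z zF [zK zne]] := neighbour_in_stack FK iF.
exists z => //; apply: contraNN zF; case: z zK zne => [k|H] _ zne.
  by rewrite mem_cap_inl mem_old_inl => /andP[].
by rewrite mem_cap_inr => /eqP HF; have := zne H erefl; rewrite HF eqxx.
Qed.

Lemma facet_sum_level e F G : (forall F, F \in K -> facet_basis v F (e F)) ->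
  F \in K -> G \in K -> G != F ->
  dot (\sum_(j in G) v j) (level e F) < d%:R.
Proof.
move=> e_basis FK GK GF; have [j jG jF] : exists2 j, j \in G & j \notin F.
  apply/subsetPn; apply: contraNN GF => sGF.
  by rewrite (facet_sub_eq K_poly GK FK sGF).
rewrite dot_suml -[d in ltRHS](facet_card K_poly GK) -sum1_card natr_sum.
rewrite (bigD1 j) //= [ltRHS](bigD1 j) //= ltr_leD ?(level_out e_basis) //.
by apply: ler_sum => k _; rewrite (level_le1 e_basis).
Qed.

(** The [d] vertices of [F] sum to a point at level [d] of [F], so the factor [(d%:R - t)^-1] puts
    the apex just beyond [F]. The cap omitting [i] has level [level F - t * e F i]. The vertex [i]
    is then at level [1 - t], and the remaining facet inequalities are finitely many strict ones
    valid at [t = 0], hence for small [t]. *)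
Lemma stack_polytope : exists v', simplicial_polytope (v' : _ -> 'rV[R]_d) stk.
Proof.
have [e e_basis] := facet_bases K_poly.
pose s (G : {set I}) := \sum_(j in G) v j.
(* For [t < m1], old vertices off [F] stay below the tilted caps over [F]. *)
have [|m1 m1_gt0 small1] := @uniformly_small R ({set I} * I * I)%type
  [pred q | [&& q.1.1 \in K, q.1.2 \in q.1.1 & q.2 \notin q.1.1]]
  (fun q => 1 - dot (v q.2) (level e q.1.1))
  (fun q => - dot (v q.2) (e q.1.1 q.1.2)).
  by move=> [[F i] j] /= /and3P[FK _ jF]; rewrite subr_gt0 (level_out e_basis).
(* For [t < m2], the apex over [G] stays below any other facet [F] ([None]) and below every cap over
   [F] ([Some i]). *)
have [|m2 m2_gt0 small2] := @uniformly_small R ({set I} * {set I} * option I)%type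
  [pred q | [&& q.1.1 \in K, q.1.2 \in K & q.1.2 != q.1.1]]
  (fun q => d%:R - dot (s q.1.2) (level e q.1.1))
  (fun q => 1 - if q.2 is Some i then dot (s q.1.2) (e q.1.1 i) else 0).
  by move=> [[F G] i] /= /and3P[FK GK GF]; rewrite subr_gt0 facet_sum_level.
pose t : R := Num.min (Num.min m1 m2) d%:R / 2.
have d0 : 0 < d%:R :> R by rewrite ltr0n.
have min_gt0 : 0 < Num.min (Num.min m1 m2) d%:R by rewrite !lt_min m1_gt0 m2_gt0.
have t0 : 0 < t by rewrite divr_gt0.
have : t < Num.min (Num.min m1 m2) d%:R by rewrite /t; lra.
rewrite !lt_min -andbA => /and3P[tm1 tm2 td].
have t_m1 : 0 < t < m1 by rewrite t0.
have t_m2 : 0 < t < m2 by rewrite t0.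
have c0 : 0 < d%:R - t by rewrite subr_gt0.
pose v' (z : stack_vertex T) : 'rV[R]_d := match z with
  inl i => v i | inr F => (d%:R - t)^-1 *: s (val F) end.
have apex_lt (G : {F : {set I} | F \in T}) c :
    dot (s (val G)) c < d%:R - t -> dot (v' (inr G)) c < 1.
  by move=> h; rewrite dotZl mulrC ltr_pdivrMr // mul1r.
have K_of (G : {F : {set I} | F \in T}) : val G \in K.
  exact: (fintype.subsetP TK) (valP G).
exists v'; split.
- move=> X /stackP[[F /setDP[FK _] ->]|[F [i iF ->]]].
    by rewrite card_old (facet_card K_poly).
  by rewrite card_cap // (facet_card K_poly).
- move=> X /stackP[[F /setDP[FK FT] ->]|[F [i iF ->]]].
    exists (fun z => if z is inl j then e F j else 0); split.
    + by move=> y; rewrite big_old; exact: (facet_expand e_basis).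
    + move=> [j|G] [k|H]; rewrite ?mem_old_inr // !mem_old_inl => jF kF.
      by rewrite /= (facet_dual e_basis FK) // (inj_eq (@inl_inj _ _)).
    + move=> z zF; rewrite big_old /= -levelE.
      case: z zF => [j|G _]; first by rewrite mem_old_inl; exact: (level_out e_basis).
      apply: apex_lt; rewrite ltrBrDr -ltrBrDl.
      have := small2 t t_m2 (F, val G, None); rewrite /= FK K_of subr0 mulr1; apply.
      by apply: contraNneq FT => <-; exact: valP.
  have FK := K_of F; set a := e (val F).
  (* Eliminate [v i] by writing it as the sum of the vertices of [F] minus the others: the
     coordinate at [i] passes to the apex, rescaled, and is subtracted from every other
     coordinate. *)
  pose e' (z : stack_vertex T) := match z with
    inl j => a j - a i | inr _ => (d%:R - t) *: a i end.
  have card_Fi : #|val F :\ i| = d.-1.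
    by rewrite -(facet_card K_poly FK) (cardsD1 i (val F)) iF.
  have dE : d%:R = d.-1%:R + 1 :> R by rewrite natr1 prednK.
  have cap_level y : \sum_(z in cap F i) dot y (e' z) =
      dot y (level e (val F)) - t * dot y (a i).
    rewrite big_cap /= dotZr levelE [in RHS](big_setD1 i) //=.
    under eq_bigr do rewrite dotBr.
    rewrite sumrB sumr_const card_Fi -[in _ *+ _]mulr_natl -/a.
    by rewrite dE; ring.
  exists e'; split.
  + move=> y; rewrite big_cap /= dotZr scalerA mulrAC mulfV ?gt_eqF // mul1r.
    rewrite /s (big_setD1 i) //= scalerDr scaler_sumr -addrA -big_split /=.
    rewrite {1}(facet_expand e_basis y FK) (big_setD1 i) //=; congr (_ + _).
    by apply: eq_bigr => j _; rewrite dotBr -scalerDl addrC subrK.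
  + have dual_s j : j \in val F -> dot (s (val F)) (a j) = 1.
      move=> jF; rewrite dot_suml (bigD1 j) //= (facet_dual e_basis FK) // eqxx.
      rewrite big1 ?addr0 // => k /andP[kF /negbTE kj].
      by rewrite (facet_dual e_basis FK) // eq_sym kj.
    move=> [j|G] [k|H]; rewrite ?mem_cap_inl ?mem_cap_inr.
    * move=> /andP[ji jF] /andP[ki kF]; rewrite /= dotBr !(facet_dual e_basis FK) //.
      by rewrite (inj_eq (@inl_inj _ _)) [i == k]eq_sym (negbTE ki) subr0.
    * by move=> /andP[ji jF] /eqP->; rewrite /= dotZl dotBr !dual_s // subrr mulr0.
    * move=> /eqP-> /andP[ki kF]; rewrite /= dotZr (facet_dual e_basis FK) //.
      by rewrite eq_sym (negbTE ki) mulr0.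
    * move=> /eqP-> /eqP->; rewrite /= dotZl dotZr dual_s // mulr1 mulVf ?gt_eqF //.
      by rewrite eqxx.
  + move=> z; rewrite cap_level; case: z => [j|G].
      rewrite mem_cap_inl negb_and negbK; have [-> _|ji /= jF] := eqVneq j i.
        rewrite /= (level_in e_basis) // (facet_dual e_basis FK) // eqxx mulr1.
        by rewrite ltrBlDr ltrDl.
      have := small1 t t_m1 (val F, i, j); rewrite /= FK iF jF mulrN => /(_ isT).
      by rewrite -/a; lra.
    rewrite mem_cap_inr => GF.
    have -> : dot (v' (inr G)) (level e (val F)) - t * dot (v' (inr G)) (a i) =
              dot (v' (inr G)) (level e (val F) - t *: a i).
      by rewrite dotBr dotZr.
    apply: apex_lt; rewrite dotBr dotZr.
    have := small2 t t_m2 (val F, val G, Some i); rewrite /= FK K_of GF => /(_ isT).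
    by rewrite mulrBr mulr1 -/a; lra.
- exact: stack_neighbour.
- move=> X /stackP[[F /setDP[FK FT] ->]|[F [i iF ->]]].
    apply: contraNneq (facet_proper K_poly FK) => /setP FT'.
    by apply/eqP/setP => j; have := FT' (inl j); rewrite mem_old_inl !inE.
  by apply/eqP => /setP/(_ (inl i)); rewrite mem_cap_inl eqxx inE.
- have [F FK] := facet_exists K_poly; apply/finset.set0Pn.
  have [FT|FT] := boolP (F \in T); last by exists (old_facet T F); exact: old_in_stack.
  have /card_gt0P[i iF] : (0 < #|F|)%N by rewrite (facet_card K_poly FK).
  by exists (cap (exist _ F FT) i); exact: cap_in_stack.
Qed.

End Stack.

(** * Automorphisms of stacked complexes *)

Section MorphGroup.
Variables (gT hT : finGroupType) (psi : gT -> hT).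
Hypothesis psiM : {morph psi : x y / (x * y)%g}.

Lemma morph_one : psi 1%g = 1%g.
Proof. by apply: (mulgI (psi 1%g)); rewrite -psiM !mulg1. Qed.

Lemma morph_inv x : psi x^-1%g = (psi x)^-1%g.
Proof. by apply: (mulgI (psi x)); rewrite -psiM !mulgV morph_one. Qed.

End MorphGroup.

Section AutAction.
Variables (gT : finGroupType) (I : finType) (K : {set {set I}}).
Variable a : gT -> I -> I.

(* [a] identifies [gT] with the group of all automorphisms of the complex [K]. *)
Definition aut_action : Prop :=
  [/\ forall i, a 1%g i = i,
      forall x y i, a (x * y)%g i = a x (a y i),
      forall x, (forall i, a x i = i) -> x = 1%g,
      forall x F, F \in K -> a x @: F \in K
    & forall f : I -> I, injective f -> (forall F, F \in K -> f @: F \in K) ->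
        exists x, f =1 a x].

Hypothesis aP : aut_action.

Lemma aut_action1 i : a 1%g i = i.
Proof. by case: aP. Qed.

Lemma aut_actionM x y i : a (x * y)%g i = a x (a y i).
Proof. by case: aP. Qed.

Lemma aut_actionK x : cancel (a x) (a x^-1%g).
Proof. by move=> i; rewrite -aut_actionM mulVg aut_action1. Qed.

Lemma aut_action_inj x : injective (a x).
Proof. exact: can_inj (aut_actionK x). Qed.

Lemma aut_action_faithful x : (forall i, a x i = i) -> x = 1%g.
Proof. by case: aP => _ _ + _ _; apply. Qed.

Lemma aut_action_facet x F : F \in K -> a x @: F \in K.
Proof. by case: aP => _ _ _ + _; apply. Qed.

Lemma aut_action_imsetM x y (F : {set I}) : a (x * y)%g @: F = a x @: (a y @: F).
Proof. by rewrite -imset_comp; apply: eq_imset => i; exact: aut_actionM. Qed.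

Lemma aut_action_imset1 (F : {set I}) : a 1%g @: F = F.
Proof. by rewrite (eq_imset _ aut_action1) imset_id. Qed.

Lemma aut_action_imsetK x (F : {set I}) : a x^-1%g @: (a x @: F) = F.
Proof. by rewrite -aut_action_imsetM mulVg aut_action_imset1. Qed.

Lemma aut_action_complete (f : I -> I) : injective f ->
  (forall F, F \in K -> f @: F \in K) -> exists x, f =1 a x.
Proof. by case: aP => _ _ _ _; apply. Qed.

End AutAction.

Section StackAut.
Variables (R : realType) (d : nat) (I : finType) (v : I -> 'rV[R]_d).
Variables (K T : {set {set I}}).
Hypothesis K_poly : simplicial_polytope v K.
Hypothesis TK : T \subset K.
Hypothesis T_cover : forall i, exists2 F, F \in T & i \in F.
Hypothesis d_gt2 : (2 < d)%N.
Local Notation stk := (stack K T).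
Local Notation apex := {F : {set I} | F \in T}.

Let apex_facet (F : apex) : val F \in K := fintype.subsetP TK _ (valP F).

Lemma apex_card (F : apex) : #|val F| = d.
Proof. exact: (facet_card K_poly). Qed.

Lemma facet_other (F : apex) (A : {set I}) : (#|A| <= 2)%N ->
  exists2 i, i \in val F & i \notin A.
Proof.
move=> A2; apply/subsetPn/negP => /subset_leq_card.
by rewrite apex_card leqNgt (leq_ltn_trans A2).
Qed.

Definition star (z : stack_vertex T) : {set stack_vertex T} :=
  \bigcup_(X in stk | z \in X) X.

Lemma mem_star z X w : X \in stk -> z \in X -> w \in X -> w \in star z.
Proof. by move=> XK zX wX; apply/bigcupP; exists X; rewrite // XK. Qed.

Lemma card_star_inr (F : apex) : (#|star (inr F)| <= d.+1)%N.
Proof.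
have -> : d.+1 = #|inr F |: old_facet T (val F)|.
  by rewrite cardsU1 mem_old_inr card_old apex_card.
apply/subset_leq_card/bigcupsP => X /andP[/stackP[[G _ ->]|[G [i iG ->]]]].
  by rewrite mem_old_inr.
rewrite mem_cap_inr => /eqP->; apply: finset.setUS; apply: imsetS.
exact: subD1set.
Qed.

(** A stacked facet [F] through [i] contributes its [d] vertices and its apex; because [2 < d], two
    caps omitting different vertices both contain [i] and together contain all of these. One more
    vertex lies across a ridge of [F] through [i]. *)
Lemma card_star_inl i : (d.+1 < #|star (inl i)|)%N.
Proof.
have [F FT iF] := T_cover i; pose F' : apex := exist _ F FT.
have [k kF ki] : exists2 k, k \in F & k \notin [set i].
  by apply: (@facet_other F'); rewrite cards1.
have [l lF lki] : exists2 l, l \in F & l \notin [set i; k].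
  by apply: (@facet_other F'); rewrite cards2; case: (i != k).
move: ki lki; rewrite !inE negb_or => ki /andP[li lk].
have kcap : cap F' k \in stk by apply: cap_in_stack.
have lcap : cap F' l \in stk by apply: cap_in_stack.
have icapk : inl i \in cap F' k by rewrite mem_cap_inl eq_sym ki.
have icapl : inl i \in cap F' l by rewrite mem_cap_inl eq_sym li.
have apexk : inr F' \in cap F' k by rewrite mem_cap_inr.
have [z zcap zK] := stack_neighbour K_poly TK kcap apexk.
(* Replacing the apex by [k] would recreate [F], which stacking has removed. *)
have zF : z \notin inr F' |: old_facet T F.
  case: z zcap zK => [j|G]; last by rewrite mem_cap_inr !inE mem_old_inr orbF.
  rewrite mem_cap_inl in_setU1 mem_old_inl /= cap_old => jk.
  have [jF|//] := boolP (j \in F); have {jk} jk : j = k.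
    by move: jk; rewrite jF andbT negbK => /eqP.
  rewrite jk /= (_ : _ |: _ = old_facet T F); last first.
    by rewrite /old_facet -imsetU1 finset.setD1K.
  case/stackP => [[G /setDP[_ GT] /imset_inj] FG|[G [m mG /setP/(_ (inr G))]]].
    by move: GT; rewrite -FG ?FT //; exact: inl_inj.
  by rewrite mem_old_inr mem_cap_inr eqxx.
have -> : d.+2 = #|z |: (inr F' |: old_facet T F)|.
  by rewrite cardsU1 zF cardsU1 mem_old_inr card_old -(apex_card F').
apply/subset_leq_card/fintype.subsetP => w /setU1P[->|/setU1P[->|]].
- apply: (mem_star zK); rewrite ?setU11 // in_setU1 in_setD1 icapk.
  by rewrite orbT.
- exact: mem_star kcap icapk apexk.
- case/imsetP => j jF ->; have [->|jk] := eqVneq j k.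
    by apply: (mem_star lcap icapl); rewrite mem_cap_inl eq_sym lk.
  by apply: (mem_star kcap icapk); rewrite mem_cap_inl jk.
Qed.

Section Automorphism.
Variable f : stack_vertex T -> stack_vertex T.
Hypothesis f_inj : injective f.
Hypothesis f_stk : forall X, X \in stk -> f @: X \in stk.

Lemma stack_aut_surj Y : Y \in stk ->
  exists2 X : {set stack_vertex T}, X \in stk & Y = f @: X.
Proof.
move=> YK; apply/imsetP; suff -> : [set f @: (X : {set stack_vertex T}) | X in stk] = stk by [].
apply/eqP; rewrite eqEcard; apply/andP; split.
  by apply/fintype.subsetP => _ /imsetP[X XK ->]; exact: f_stk.
by rewrite card_imset //; exact: imset_inj.
Qed.

Lemma stack_aut_star z : star (f z) = f @: star z.
Proof.
apply/setP => w; apply/bigcupP/imsetP => [[Y /andP[YK]]|[u /bigcupP[X /andP[XK zX]]]].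
  have [X XK ->] := stack_aut_surj YK; rewrite mem_imset // => zX /imsetP[u uX ->].
  by exists u => //; exact: mem_star XK zX uX.
by move=> uX ->; exists (f @: X); rewrite ?f_stk ?mem_imset.
Qed.

Lemma stack_aut_card_star z : #|star (f z)| = #|star z|.
Proof. by rewrite stack_aut_star card_imset. Qed.

Lemma stack_aut_inl i : exists j, f (inl i) = inl j.
Proof.
case fi: (f (inl i)) => [j|G]; first by exists j.
have := card_star_inl i; rewrite -stack_aut_card_star fi ltnNge.
by rewrite card_star_inr.
Qed.

Lemma stack_aut_inr F : exists G, f (inr F) = inr G.
Proof.
case fF: (f (inr F)) => [j|G]; last by exists G.
have := card_star_inr F; rewrite -stack_aut_card_star fF leqNgt.
by rewrite card_star_inl.
Qed.

Lemma stack_aut_restrict : exists f0 : I -> I,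
  [/\ injective f0, forall F, F \in K -> f0 @: F \in K,
      forall i, f (inl i) = inl (f0 i)
    & forall F, exists2 G, f (inr F) = inr G & val G = f0 @: val F].
Proof.
have [f0 f0E] := choice stack_aut_inl; have [f1 f1E] := choice stack_aut_inr.
have f0_inj : injective f0.
  by move=> i j fij; apply: (@inl_inj _ T); apply: f_inj; rewrite !f0E fij.
have f1_val F : val (f1 F) = f0 @: val F.
  apply/esym/eqP; rewrite eqEcard card_imset // !apex_card leqnn andbT.
  apply/fintype.subsetP => _ /imsetP[k kF ->].
  have [i iF] : exists2 i, i \in val F & i \notin [set k].
    by apply: facet_other; rewrite cards1.
  rewrite inE eq_sym => ki; have := f_stk (cap_in_stack K iF).
  have F1 : inr (f1 F) \in f @: cap F i by rewrite -f1E mem_imset // mem_cap_inr.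
  have k1 : inl (f0 k) \in f @: cap F i by rewrite -f0E mem_imset // mem_cap_inl ki.
  case/stackP => [[G _ capE]|[G [j _ capE]]]; move: F1 k1; rewrite capE.
    by rewrite mem_old_inr.
  by rewrite mem_cap_inr mem_cap_inl => /eqP-> /andP[].
exists f0; split=> // [F FK|F]; last by exists (f1 F); rewrite ?f1E ?f1_val.
have [FT|FT] := boolP (F \in T).
  by have := apex_facet (f1 (exist _ F FT)); rewrite f1_val.
have fF : f @: old_facet T F = old_facet T (f0 @: F).
  by rewrite /old_facet -!imset_comp; apply: eq_imset => i /=; rewrite f0E.
have := f_stk (old_in_stack FK FT); rewrite fF.
case/stackP => [[G /setDP[GK _]]|[G [j _ /setP/(_ (inr G))]]].
  by move/imset_inj => -> //; exact: inl_inj.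
by rewrite mem_old_inr mem_cap_inr eqxx.
Qed.

End Automorphism.

Variables (gT hT : finGroupType) (a : hT -> I -> I) (psi : gT -> hT).
Hypothesis aP : aut_action K a.
Hypothesis psi_inj : injective psi.
Hypothesis psiM : {morph psi : x y / (x * y)%g}.
Hypothesis psi_stab : forall x,
  (forall F, F \in T -> a x @: F \in T) <-> exists g, psi g = x.

(** The image of a member of [T] is again in [T] by [psi_T], so [insubd] never falls back on its
    default. *)
Definition stack_action g (z : stack_vertex T) : stack_vertex T := match z with
  | inl i => inl (a (psi g) i)
  | inr F => inr (insubd F (a (psi g) @: val F)) end.

Lemma psi_T g F : F \in T -> a (psi g) @: F \in T.
Proof. by move=> FT; apply: (psi_stab _).2 => //; exists g. Qed.

Let psi1 := morph_one psiM.
Let psiV := morph_inv psiM.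

Lemma val_stack_apex g (F : apex) :
  val (insubd F (a (psi g) @: val F)) = a (psi g) @: val F.
Proof. by rewrite insubdK // psi_T // (valP F). Qed.

Lemma stack_action1 z : stack_action 1%g z = z.
Proof.
case: z => [i|F] /=; first by rewrite psi1 (aut_action1 aP).
by congr inr; apply: val_inj; rewrite val_stack_apex psi1 (aut_action_imset1 aP).
Qed.

Lemma stack_actionM g h z :
  stack_action (g * h)%g z = stack_action g (stack_action h z).
Proof.
case: z => [i|F] /=; first by rewrite psiM (aut_actionM aP).
congr inr; apply: val_inj; rewrite val_stack_apex [RHS]val_stack_apex.
by rewrite val_stack_apex psiM (aut_action_imsetM aP).
Qed.

Lemma stack_action_cap g F i :
  stack_action g @: cap F i = cap (insubd F (a (psi g) @: val F)) (a (psi g) i).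
Proof.
rewrite /cap imsetU1 /= -imset_comp val_stack_apex; congr (_ |: _).
have -> : (a (psi g) @: val F) :\ a (psi g) i = a (psi g) @: (val F :\ i).
  apply/setP => j; rewrite in_setD1.
  apply/andP/imsetP => [[ji /imsetP[k kF jk]]|[k /setD1P[ki kF] ->]].
    exists k => //; rewrite !inE kF andbT.
    by apply: contraNneq ji => <-; rewrite jk.
  by split; [rewrite (inj_eq (aut_action_inj aP (x := _))) | exact: imset_f].
by rewrite -imset_comp.
Qed.

Lemma stack_action_old g F :
  stack_action g @: old_facet T F = old_facet T (a (psi g) @: F).
Proof. by rewrite /old_facet -!imset_comp. Qed.

Lemma stack_aut_action : aut_action stk stack_action.
Proof.
split.
- exact: stack_action1.
- exact: stack_actionM.
- move=> g g1; apply: psi_inj; rewrite psi1; apply: (aut_action_faithful aP) => i.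
  by have := g1 (inl i) => -[].
- move=> g X /stackP[[F /setDP[FK FT] ->]|[F [i iF ->]]].
    rewrite stack_action_old old_in_stack ?(aut_action_facet aP) //.
    apply: contraNN FT => /(psi_T g^-1%g).
    by rewrite psiV (aut_action_imsetK aP).
  by rewrite stack_action_cap cap_in_stack // val_stack_apex imset_f.
- move=> f f_inj f_stk; have [f0 [f0_inj f0_K f0E f1E]] := stack_aut_restrict f_inj f_stk.
  have [x f0x] := aut_action_complete aP f0_inj f0_K.
  have [g gx] : exists g, psi g = x.
    apply/psi_stab => F FT; rewrite -(eq_imset _ f0x).
    by have [G _ <-] := f1E (exist _ F FT); exact: valP.
  exists g => -[i|F]; first by rewrite f0E /= gx f0x.
  have [G -> GE] := f1E F; congr inr; apply: val_inj.
  by rewrite val_stack_apex GE gx (eq_imset _ f0x).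
Qed.

Lemma stack_cover z : exists2 X, X \in stk & z \in X.
Proof.
case: z => [i|F].
  have [F FT iF] := T_cover i.
  have [k kF ki] := @facet_other (exist _ F FT) [set i] (leqW (eq_leq (cards1 i))).
  exists (cap (exist _ F FT) k); first exact: cap_in_stack.
  by rewrite mem_cap_inl iF andbT; move: ki; rewrite inE eq_sym.
have [k kF _] := @facet_other F finset.set0 (leq_trans (eq_leq (cards0 _)) isT).
by exists (cap F k); [exact: cap_in_stack | rewrite mem_cap_inr].
Qed.

(** A cap determines [F] through its apex, and [i] as the one vertex of [F] that it omits. *)
Lemma stack_stab g (F : apex) i : i \in val F -> stack_action g @: cap F i = cap F i ->
  a (psi g) @: val F = val F /\ a (psi g) i = i.
Proof.
move=> iF; rewrite stack_action_cap => capE.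
have FE : insubd F (a (psi g) @: val F) = F.
  by apply/eqP; rewrite eq_sym -(mem_cap_inr _ (a (psi g) i)) capE mem_cap_inr.
have aF : a (psi g) @: val F = val F by rewrite -val_stack_apex FE.
split=> //; apply/eqP; apply: contraTT isT => ai.
have /setP/(_ (inl (a (psi g) i))) := capE.
have aiF : a (psi g) i \in val F by rewrite -aF imset_f.
by rewrite !mem_cap_inl eqxx ai aiF.
Qed.

End StackAut.

(** * Facets with trivial stabilizer and prescribed groups *)

Section Prescribe.
Variables (R : realType) (d : nat).
Hypothesis d_gt2 : (2 < d)%N.

Definition facet_cover (I : finType) (K : {set {set I}}) : Prop :=
  forall i, exists2 F, F \in K & i \in F.

Definition realizable (gT : finGroupType) : Prop :=
  exists (I : finType) (v : I -> 'rV[R]_d) (K : {set {set I}}) (a : gT -> I -> I),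
    [/\ simplicial_polytope v K, aut_action K a & facet_cover K].

Definition rigid (gT : finGroupType) (I : finType) (a : gT -> I -> I)
    (F : {set I}) : Prop := forall x, a x @: F = F -> x = 1%g.

Section FullStack.
Variables (gT : finGroupType) (I : finType) (v : I -> 'rV[R]_d).
Variables (K : {set {set I}}) (a : gT -> I -> I).
Hypotheses (K_poly : simplicial_polytope v K) (aP : aut_action K a).
Hypothesis K_cover : facet_cover K.

Definition full_action := @stack_action I K gT gT a id.

Lemma id_stab x : (forall F, F \in K -> a x @: F \in K) <-> exists g : gT, id g = x.
Proof.
by split=> [_|_ F FK]; [exists x | exact: (aut_action_facet aP)].
Qed.

Lemma full_aut_action : aut_action (stack K K) full_action.
Proof.
apply: (stack_aut_action K_poly (fintype.subxx K) K_cover d_gt2 aP) => //.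
exact: id_stab.
Qed.

Lemma full_polytope : exists v', simplicial_polytope (v' : _ -> 'rV[R]_d) (stack K K).
Proof.
by apply: (stack_polytope K_poly (fintype.subxx K)); exact: ltn_trans d_gt2.
Qed.

Lemma full_cover : facet_cover (stack K K).
Proof. exact: (stack_cover K_poly (fintype.subxx K) K_cover d_gt2). Qed.

Lemma full_stab x (F : {F : {set I} | F \in K}) i : i \in val F ->
  full_action x @: cap F i = cap F i -> a x @: val F = val F /\ a x i = i.
Proof. exact: (stack_stab aP (@id_stab)). Qed.

End FullStack.

(** Induction on the order of the stabilizer of [F]. A nontrivial [x] stabilizing [F] moves some
    vertex [i] of it; in the full stacking, the stabilizer of [cap F i] embeds in that of [F] and
    misses [x]. Fixing this cap pointwise still fixes [F] pointwise, so the hypothesis persists. *)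
Lemma rigid_facet (gT : finGroupType) (I : finType) (v : I -> 'rV[R]_d)
    (K : {set {set I}}) (a : gT -> I -> I) (F : {set I}) :
  simplicial_polytope v K -> aut_action K a -> facet_cover K -> F \in K ->
  (forall x, {in F, forall i, a x i = i} -> x = 1%g) ->
  exists (I' : finType) (v' : I' -> 'rV[R]_d) (K' : {set {set I'}})
         (a' : gT -> I' -> I'),
    [/\ simplicial_polytope v' K', aut_action K' a', facet_cover K'
      & exists2 F', F' \in K' & rigid a' F'].
Proof.
have [n] := ubnP #|[set x | a x @: F == F]|.
elim: n I v K a F => // n IH I v K a F hn K_poly aP K_cover FK pt.
have [/existsP[x /andP[/eqP xF x1]]|] := boolP [exists x, (a x @: F == F) && (x != 1%g)];
  last first.
  rewrite negb_exists => /forallP rF; exists I, v, K, a; split=> //.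
  exists F => // x xF; apply/eqP; apply: contraT => x1.
  by have := rF x; rewrite xF eqxx x1.
have [i iF xi] : exists2 i, i \in F & a x i != i.
  apply/exists_inP; apply: contraT => /exists_inPn h; case/eqP: x1; apply: pt.
  by move=> i /h; rewrite negbK => /eqP.
have [v' K'_poly] := full_polytope K_poly.
pose F' : {F : {set I} | F \in K} := exist _ F FK.
apply: (IH _ v' (stack K K) (full_action a) (cap F' i)) => //.
- apply: leq_trans (_ : #|[set x | a x @: F == F]| <= n)%N => //.
  apply/proper_card; rewrite properE; apply/andP; split.
    apply/fintype.subsetP => y; rewrite !inE => /eqP.
    by case/(full_stab aP (F := F') iF) => /= ->.
  apply/subsetPn; exists x; rewrite !inE ?xF //.
  by apply: contra xi => /eqP/(full_stab aP (F := F') iF)[_ ->].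
- exact: full_aut_action K_poly aP K_cover.
- exact: full_cover K_poly K_cover.
- exact: cap_in_stack.
- move=> y y1; apply: pt => j jF.
  have [yF yi] : a y @: F = F /\ a y i = i.
    apply: (full_stab aP (F := F') iF).
    by rewrite -[RHS]imset_id; apply: eq_in_imset => z /y1.
  have [->//|ji] := eqVneq j i.
  by have [] : inl (a y j) = inl j :> stack_vertex K
    by apply: (y1 (inl j)); rewrite mem_cap_inl ji.
Qed.

Lemma prescribe (gT hT : finGroupType) (psi : gT -> hT) (I : finType)
    (v : I -> 'rV[R]_d) (K : {set {set I}}) (a : hT -> I -> I) (F : {set I}) :
  {morph psi : x y / (x * y)%g} -> injective psi ->
  simplicial_polytope v K -> aut_action K a -> facet_cover K ->
  F \in K -> rigid a F -> realizable gT.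
Proof.
move=> psiM psi_inj K_poly aP K_cover FK F_rigid.
have [v1 K1_poly] := full_polytope K_poly.
have a1P := full_aut_action K_poly aP K_cover.
set K1 := stack K K in K1_poly a1P; set a1 := full_action a in a1P.
pose F0 : {F : {set I} | F \in K} := exist _ F FK.
have F_card : #|F| = d by exact: (facet_card K_poly FK).
have [i0 i0F] : exists i, i \in F.
  by apply/card_gt0P; rewrite F_card; exact: ltn_trans d_gt2.
pose F1 := cap F0 i0; have F1K : F1 \in K1 by exact: cap_in_stack.
have a1_cap x : a1 x @: F1 = cap (insubd F0 (a x @: F)) (a x i0).
  exact: (stack_action_cap aP (@id_stab _ _ _ _ aP)).
have F1_rigid : rigid a1 F1.
  by move=> x /(full_stab aP (F := F0) i0F)[/F_rigid].
pose orbit := [set a1 (psi g) @: F1 | g : gT].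
pose T := K1 :\: orbit.
have TK : T \subset K1 by exact: finset.subsetDl.
(* Both caps come from elements carrying [F] to [G]; by rigidity these coincide, and the omitted
   vertex is the image of [i0]. *)
have few (G : {F : {set I} | F \in K}) i j : cap G i \in orbit -> cap G j \in orbit ->
    i \in val G -> j \in val G -> i = j.
  move=> /imsetP[g _ gE] /imsetP[h _ hE] iG jG.
  have apexE x k : cap G k = a1 x @: F1 -> val G = a x @: F.
    rewrite a1_cap => cE; have : inr G \in cap G k by rewrite mem_cap_inr.
    rewrite cE mem_cap_inr => /eqP->.
    by rewrite insubdK // (aut_action_facet aP).
  have idx x k : k \in val G -> cap G k = a1 x @: F1 -> k = a x i0.
    move=> kG cE; have GE := apexE x k cE.
    have : inl k \notin cap G k by rewrite mem_cap_inl eqxx.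
    rewrite {1}cE a1_cap mem_cap_inl insubdK ?(aut_action_facet aP) // -GE kG andbT.
    by rewrite negbK => /eqP.
  have gh : psi g = psi h.
    apply: (mulgI (psi g)^-1%g); rewrite mulVg; apply/esym/F_rigid.
    rewrite (aut_action_imsetM aP) -(apexE _ _ hE) (apexE _ _ gE).
    exact: (aut_action_imsetK aP).
  by rewrite (idx _ _ iG gE) (idx _ _ jG hE) gh.
(* One index may be forbidden by [A] and one more by the orbit, which is affordable because [G] has
   at least three vertices. *)
have two (G : {F : {set I} | F \in K}) (A : {set I}) : (#|A| <= 1)%N ->
    exists i, [/\ i \in val G, i \notin A & cap G i \in T].
  move=> A1; have [i iG iA] := facet_other K_poly (fintype.subxx K) d_gt2 G (leqW A1).
  have [j jG] : exists2 j, j \in val G & j \notin i |: A.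
    apply: (facet_other K_poly (fintype.subxx K) d_gt2).
    by rewrite cardsU1 iA add1n ltnS.
  rewrite !inE negb_or => /andP[ji jA].
  have [iO|iO] := boolP (cap G i \in orbit); last first.
    by exists i; split=> //; rewrite inE iO cap_in_stack.
  exists j; split=> //; rewrite inE cap_in_stack // andbT.
  by apply: contraNN ji => jO; apply/eqP; exact: few jO iO jG iG.
have T_cover : facet_cover T.
  case=> [i|G].
    have [G GK iG] := K_cover i.
    have [k [kG ki kT]] := two (exist _ G GK) [set i] (eq_leq (cards1 i)).
    by exists (cap (exist _ G GK) k); rewrite // mem_cap_inl iG andbT;
       move: ki; rewrite inE eq_sym.
  have [k [kG _ kT]] := two G finset.set0 (leqW (eq_leq (cards0 _))).
  by exists (cap G k); rewrite // mem_cap_inr.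
have [psi1 psiV] := (morph_one psiM, morph_inv psiM).
have orbit_act g X : X \in orbit -> a1 (psi g) @: X \in orbit.
  move=> /imsetP[h _ ->]; apply/imsetP; exists (g * h)%g => //.
  by rewrite psiM (aut_action_imsetM a1P).
have T_stab x : (forall X, X \in T -> a1 x @: X \in T) <-> exists g, psi g = x.
  split=> [xT|[g <-] X /setDP[XK XO]]; last first.
    rewrite inE (aut_action_facet a1P) // andbT; apply: contraNN XO.
    by move=> /(orbit_act g^-1%g); rewrite psiV (aut_action_imsetK a1P).
  have x_inj := imset_inj (@aut_action_inj _ _ _ _ a1P x).
  have xTE : [set a1 x @: (X : {set stack_vertex K}) | X in T] = T.
    apply/eqP; rewrite eqEcard; apply/andP; split.
      by apply/fintype.subsetP => _ /imsetP[X XT ->]; exact: xT.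
    by rewrite card_imset //; exact: x_inj.
  (* By finiteness [x] permutes [T], so it cannot send [F1], which lies outside [T], into [T]. *)
  have : a1 x @: F1 \in orbit.
    apply: contraT => xO; have : a1 x @: F1 \in T.
      by rewrite inE xO (aut_action_facet a1P).
    rewrite -{1}xTE => /imsetP[X XT /x_inj eqX].
    have F1O : F1 \in orbit.
      by apply/imsetP; exists 1%g => //; rewrite psi1 (aut_action_imset1 a1P).
    by move: XT; rewrite -eqX inE F1O.
  move=> /imsetP[g _ xg]; exists g; apply: (mulgI x^-1%g); rewrite mulVg.
  by apply: F1_rigid; rewrite (aut_action_imsetM a1P) -xg (aut_action_imsetK a1P).
have [v2 K2_poly] := stack_polytope K1_poly TK (ltn_trans (isT : 0 < 2)%N d_gt2).
exists (stack_vertex T), v2, (stack K1 T), (@stack_action _ T _ _ a1 psi); split=> //.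
  exact: (stack_aut_action K1_poly TK T_cover d_gt2 a1P psi_inj psiM T_stab).
exact: (stack_cover K1_poly TK T_cover d_gt2).
Qed.

End Prescribe.

(** * Realization *)

Lemma group_isoI (G H : groupType) (f : G -> H) :
  {morph f : x y / (x * y)%g} -> bijective f -> group_iso G H.
Proof.
move=> fM bij_f.
pose F : {multiplicative G -> H} := HB.pack f (isMultiplicative.Build G H f fM).
by exists F.
Qed.

Lemma order_aut_transport (disp disp' : Order.disp_t) (S : porderType disp)
    (T : porderType disp') (G : groupType) :
  order_iso S T -> group_iso G (order_aut S) -> group_iso G (order_aut T).
Proof.
move=> [f [f' fK f'K] f_mono] [phi [phi' phiK phi'K]].
have f'_mono : {mono f' : x y / (x <= y)%O}.
  by move=> x y; rewrite -f_mono !f'K.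
have conjP (u : order_aut S) : `[< is_order_aut (f \o val u \o f') >].
  apply/asboolP; have [[u' uK u'K] u_mono] := order_autP u; split.
    exists (f \o u' \o f') => x /=; first by rewrite fK uK f'K.
    by rewrite fK u'K f'K.
  by move=> x y /=; rewrite f_mono u_mono f'_mono.
have conjP' (u : order_aut T) : `[< is_order_aut (f' \o val u \o f) >].
  apply/asboolP; have [[u' uK u'K] u_mono] := order_autP u; split.
    exists (f' \o u' \o f) => x /=; first by rewrite f'K uK fK.
    by rewrite f'K u'K fK.
  by move=> x y /=; rewrite f'_mono u_mono f_mono.
apply: (@group_isoI _ _ (fun g => OrderAut (conjP (phi g)))).
  move=> g h; apply: val_inj; apply/funext => x /=.
  by rewrite fK gmulfM.
exists (fun u => phi' (OrderAut (conjP' u))) => [g|u].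
  rewrite -[RHS]phiK; congr phi'; apply: val_inj; apply/funext => x /=.
  by rewrite !fK.
apply: val_inj; apply/funext => x /=; rewrite phi'K /=.
by rewrite !f'K.
Qed.

Section FacesAut.
Variables (R : realType) (d : nat) (I : finType) (v : I -> 'rV[R]_d).
Variables (K : {set {set I}}) (gT : finGroupType) (a : gT -> I -> I).
Hypothesis K_poly : simplicial_polytope v K.
Hypothesis aP : aut_action K a.
Hypothesis vertexK : forall i, is_face_set K [set i].
Local Notation Q := (faces K).

Lemma act_face_set g (S : {set I}) : is_face_set K S -> is_face_set K (a g @: S).
Proof.
move=> /or3P[/eqP->|/eqP->|/exists_inP[F FK SF]].
- by rewrite imset0 is_face_set0.
- suff -> : a g @: finset.setT = finset.setT by exact: is_face_setT.
  apply/setP => i; rewrite inE -[i](aut_actionK aP g^-1%g) invgK.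
  by rewrite imset_f ?inE.
- by apply: sub_facet_face (imsetS _ SF); exact: aut_action_facet.
Qed.

Definition act_face g (x : Q) : Q := Faces (act_face_set g (valP x)).

Lemma act_faceM g h x : act_face (g * h)%g x = act_face g (act_face h x).
Proof. by apply: val_inj; rewrite /= (aut_action_imsetM aP). Qed.

Lemma act_face1 x : act_face 1%g x = x.
Proof. by apply: val_inj; rewrite /= (aut_action_imset1 aP). Qed.

Lemma act_face_mono g : {mono act_face g : x y / (x <= y)%O}.
Proof.
move=> x y; rewrite !faces_leE /=; apply/idP/idP => [|/imsetS]; last exact.
move=> /fintype.subsetP h; apply/fintype.subsetP => i ix.
by have := h (a g i); rewrite !(mem_imset _ _ (aut_action_inj aP (x := g))); apply.
Qed.

Lemma act_face_aut g : `[< is_order_aut (act_face g) >].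
Proof.
apply/asboolP; split; last exact: act_face_mono.
exists (act_face g^-1%g) => x; rewrite -act_faceM ?mulVg ?mulgV; exact: act_face1.
Qed.

Definition vertex i : Q := Faces (vertexK i).

Lemma vertex_le i (x : Q) : (vertex i <= x)%O = (i \in (x : {set I})).
Proof. exact: finset.sub1set. Qed.

Lemma vertex_not_least i : (forall x, vertex i <= x)%O -> False.
Proof. by move=> /(_ (Faces (is_face_set0 K))); rewrite vertex_le inE. Qed.

(** The image of a vertex is nonempty and contains some [j]. The preimage of [j] is nonempty and
    lies below the vertex [i], hence equals it. *)
Lemma order_aut_vertex (u u' : Q -> Q) : cancel u u' -> cancel u' u ->
  {mono u : x y / (x <= y)%O} -> {mono u' : x y / (x <= y)%O} ->
  forall i, exists j, u (vertex i) = vertex j.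
Proof.
move=> uK u'K u_mono u'_mono i.
have nonempty (w w' : Q -> Q) k : cancel w' w -> {mono w : x y / (x <= y)%O} ->
    exists j, j \in (w (vertex k) : {set I}).
  move=> wK w_mono; apply/finset.set0Pn; apply: contra_notN (@vertex_not_least k).
  by move=> /eqP w0 x; rewrite -w_mono faces_leE w0 finset.sub0set.
have [j ju] := nonempty u u' i u'K u_mono; exists j.
have [k ku] := nonempty u' u j uK u'_mono.
have ji : (vertex j <= u (vertex i))%O by rewrite vertex_le.
have : (u' (vertex j) <= vertex i)%O by rewrite -u_mono u'K.
move=> h; apply/eqP; rewrite Order.POrderTheory.eq_le ji andbT -u'_mono uK.
have : k \in (vertex i : {set I}) by exact: (fintype.subsetP h _ ku).
by rewrite inE => /eqP ki; rewrite vertex_le -ki.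
Qed.

(** Since every singleton is a face, an order automorphism induces a map [f] on indices and acts on
    each face as image under [f]. Facets go to facets because a proper face with [d] vertices is a
    facet. *)
Lemma faces_group_iso : group_iso gT (order_aut Q).
Proof.
apply: (@group_isoI _ _ (fun g => OrderAut (act_face_aut g))).
  by move=> g h; apply: val_inj; apply/funext => x; exact: act_faceM.
have phi_inj : injective (fun g => OrderAut (act_face_aut g)).
  move=> g h [gh]; apply: (mulgI h^-1%g); rewrite mulVg.
  apply: (aut_action_faithful aP) => i; rewrite (aut_actionM aP).
  have := congr1 (fun u : Q -> Q => u (vertex i)) gh => /(congr1 val) /=.
  by rewrite !imset_set1 => /set1_inj->; exact: (aut_actionK aP h).
have phi_surj (u : order_aut Q) : exists g, OrderAut (act_face_aut g) = u.
  have [[u' uK u'K] u_mono] := order_autP u.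
  have u'_mono : {mono u' : x y / (x <= y)%O} by move=> x y; rewrite -u_mono !u'K.
  have [f fE] := choice (order_aut_vertex uK u'K u_mono u'_mono).
  have f_inj : injective f.
    move=> i j fij; have : vertex i = vertex j.
      by apply: (can_inj uK); rewrite !fE fij.
    by move=> /(congr1 val) /set1_inj.
  have [f' fK f'K] : bijective f by exact: injF_bij.
  have uE (x : Q) : val u x = f @: x :> {set I}.
    apply/setP => j; rewrite -[j]f'K mem_imset // -!vertex_le -fE.
    exact: u_mono.
  have f_K F : F \in K -> f @: F \in K.
    move=> FK; pose x : Q := facet_face FK.
    have f_face : is_face_set K (f @: F) by rewrite -(uE x); exact: (valP (val u x)).
    have [|G GK xG] := face_sub_facet K_poly f_face.
      apply: contraNneq (facet_proper K_poly FK) => /setP fT.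
      by apply/eqP/setP => i; have := fT (f i); rewrite mem_imset // !inE.
    suff -> : f @: F = G by [].
    by apply/eqP; rewrite eqEcard xG card_imset // !(facet_card K_poly) ?leqnn.
  have [g fg] := aut_action_complete aP f_inj f_K; exists g.
  apply: val_inj; apply/funext => x; apply: val_inj.
  rewrite -[RHS]/(face_verts (val u x)) uE /=; apply: eq_imset => i.
  by rewrite fg.
have [phi' phi'K] := choice phi_surj; exists phi' => // g.
by apply: phi_inj; rewrite phi'K.
Qed.

End FacesAut.

(** * The simplex and the symmetric group *)

Section Simplex.
Variables (R : realType) (d : nat).
Implicit Types (i j k : 'I_d.+1).

(* The standard basis together with the opposite of its sum. *)
Definition simplex_vertex i : 'rV[R]_d :=
  \row_m ((lift ord_max m == i)%:R - (i == ord_max)%:R).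

Definition simplex_facets : {set {set 'I_d.+1}} := [set [set~ k] | k : 'I_d.+1].

(** The vertices sum to zero, so coefficients on them are determined up to a common constant,
    normalized here to vanish at [ord_max]. Subtracting the coefficient at [k] gives the basis dual
    to the facet omitting [k]. *)
Definition simplex_coord i : 'cV[R]_d :=
  if unlift ord_max i is Some m then delta_mx m 0 else 0.

Lemma dot_delta (y : 'rV[R]_d) m : dot y (delta_mx m 0) = y 0 m.
Proof. by rewrite /dot -colE mxE. Qed.

Lemma simplex_coord_lift (y : 'rV[R]_d) m :
  dot y (simplex_coord (lift ord_max m)) = y 0 m.
Proof. by rewrite /simplex_coord liftK dot_delta. Qed.

Lemma simplex_coord_max (y : 'rV[R]_d) : dot y (simplex_coord ord_max) = 0.
Proof. by rewrite /simplex_coord unlift_none dot0r. Qed.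

Lemma simplex_coord_vertex i j :
  dot (simplex_vertex j) (simplex_coord i) = (i == j)%:R - (j == ord_max)%:R.
Proof.
have [m ->|->] := unliftP ord_max i; first by rewrite simplex_coord_lift mxE.
by rewrite simplex_coord_max eq_sym subrr.
Qed.

Lemma mem_simplex_facets F :
  reflect (exists k, F = [set~ k]) (F \in simplex_facets).
Proof. by apply: (iffP imsetP) => [[k _ ->]|[k ->]]; exists k. Qed.

Lemma simplex_polytope : simplicial_polytope simplex_vertex simplex_facets.
Proof.
split.
- by move=> F /mem_simplex_facets[k ->]; rewrite cardsC1 card_ord.
- move=> F /mem_simplex_facets[k ->].
  exists (fun i => simplex_coord i - simplex_coord k); split.
  + move=> y; apply/rowP => m; rewrite summxE.
    pose H i := dot y (simplex_coord i).
    have -> : \sum_(i in [set~ k])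
        (dot y (simplex_coord i - simplex_coord k) *: simplex_vertex i) 0 m =
        \sum_i ((H i - H k) * (lift ord_max m == i)%:R -
                (H i - H k) * (i == ord_max)%:R).
      rewrite [RHS](bigD1 k) //= subrr !mul0r subr0 add0r.
      by apply: eq_big => [i|i _]; rewrite ?inE // !mxE dotBr mulrBr.
    rewrite sumrB (bigD1 (lift ord_max m)) //= eqxx mulr1 big1 ?addr0; last first.
      by move=> i /negbTE im; rewrite eq_sym im mulr0.
    rewrite (bigD1 ord_max) //= eqxx mulr1 big1 ?addr0; last first.
      by move=> i /negbTE->; rewrite mulr0.
    by rewrite /H simplex_coord_max simplex_coord_lift; ring.
  + move=> i j; rewrite !inE => ik jk; rewrite dotBr !simplex_coord_vertex.
    by rewrite [k == j]eq_sym (negbTE jk) sub0r opprK subrK.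
  + move=> j; rewrite !inE negbK => /eqP->.
    apply: (@le_lt_trans _ _ 0); last exact: ltr01.
    apply: sumr_le0 => i; rewrite !inE => /negbTE ik.
    rewrite dotBr !simplex_coord_vertex ik eqxx sub0r opprB addKr.
    by rewrite oppr_le0 ler01.
- move=> F i /mem_simplex_facets[k ->]; rewrite !inE => ik; exists k.
    by rewrite !inE eqxx.
  apply/mem_simplex_facets; exists i; apply/setP => j; rewrite !inE.
  by have [->|] := eqVneq j k; [rewrite eq_sym ik | rewrite andbT].
- move=> F /mem_simplex_facets[k ->]; apply/eqP => /setP/(_ k).
  by rewrite !inE eqxx.
- by apply/finset.set0Pn; exists [set~ ord0]; apply/mem_simplex_facets; exists ord0.
Qed.

(** Products of permutations apply the left factor first, whereas [aut_action] is a left action;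
    hence the inverse. *)
Definition simplex_action (s : 'S_d.+1) i := (s^-1)%g i.

Lemma simplex_aut_action : aut_action simplex_facets simplex_action.
Proof.
have sC (f : 'I_d.+1 -> 'I_d.+1) k : injective f -> f @: [set~ k] = [set~ f k].
  move=> f_inj; have [f' fK f'K] := injF_bij f_inj.
  by apply/setP => i; rewrite -[i]f'K mem_imset // !inE (inj_eq f_inj).
rewrite /simplex_action; split.
- by move=> i; rewrite invg1 perm1.
- by move=> s t i; rewrite invMg permM.
- by move=> s s1; apply: invg_inj; apply/permP => i; rewrite s1 invg1 perm1.
- move=> s F /mem_simplex_facets[k ->]; rewrite sC; last exact: perm_inj.
  by apply/mem_simplex_facets; exists ((s^-1)%g k).
- move=> f f_inj _; exists (perm f_inj)^-1%g => i.
  by rewrite invgK permE.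
Qed.

Lemma simplex_face_vertex i : is_face_set simplex_facets [set i].
Proof.
have [->|iT] := eqVneq [set i] finset.setT; first exact: is_face_setT.
have [k ki] : exists k, k \notin [set i].
  apply/existsP; rewrite -negb_forall; apply: contraNN iT => /forallP h.
  by apply/eqP/setP => k; rewrite h inE.
apply: (sub_facet_face (F := [set~ k])); first by apply/mem_simplex_facets; exists k.
by rewrite finset.sub1set !inE; move: ki; rewrite inE eq_sym.
Qed.

End Simplex.

Lemma aut_action_bij (gT hT : finGroupType) (I : finType) (K : {set {set I}})
    (a : hT -> I -> I) (psi : gT -> hT) :
  {morph psi : x y / (x * y)%g} -> bijective psi ->
  aut_action K a -> aut_action K (fun g => a (psi g)).
Proof.
move=> psiM [psi' psiK psi'K] aP.
have psi1 := morph_one psiM.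
split.
- by move=> i; rewrite psi1 (aut_action1 aP).
- by move=> x y i; rewrite psiM (aut_actionM aP).
- by move=> x /(aut_action_faithful aP) px; rewrite -[x]psiK px -psi1 psiK.
- by move=> x F; exact: aut_action_facet.
- move=> f f_inj /(aut_action_complete aP f_inj)[x fx]; exists (psi' x) => i.
  by rewrite psi'K fx.
Qed.

Definition polytopal_realization (R : realType) (gT : finGroupType) d : Prop :=
  exists (disp : Order.disp_t) (Q : finTBPOrderType disp) (P : set 'rV[R]_d),
    [/\ abstract_polytope d Q, group_iso gT (order_aut Q), spherical R d Q
      & convex_polytope d.+1 P /\ order_iso Q (face_lattice P)].

Lemma simplicial_realization (R : realType) (gT : finGroupType) d (I : finType)
    (v : I -> 'rV[R]_d) (K : {set {set I}}) (a : gT -> I -> I) :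
  simplicial_polytope v K -> aut_action K a ->
  (forall i, is_face_set K [set i]) -> polytopal_realization R gT d.
Proof.
move=> K_poly aP vertexK.
have [e e_basis] := facet_bases K_poly.
exists set_display, (faces K), (conv_set v finset.setT); split.
- exact: faces_abstract_polytope K_poly e_basis.
- exact: faces_group_iso K_poly aP vertexK.
- exact: faces_spherical K_poly e_basis.
- split; first exact: simplicial_convex_polytope K_poly e_basis.
  exact: face_lattice_iso K_poly e_basis.
Qed.

Lemma simplex_realization (R : realType) (gT : finGroupType) d (psi : gT -> 'S_d.+1) :
  {morph psi : x y / (x * y)%g} -> injective psi -> #|gT| = d.+1`! ->
  polytopal_realization R gT d.
Proof.
move=> psiM psi_inj card_gT.
have psi_bij : bijective psi.
  by apply: inj_card_bij => //; rewrite card_gT card_Sn.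
apply: (simplicial_realization (simplex_polytope R d)).
  exact: aut_action_bij psiM psi_bij (simplex_aut_action d).
exact: simplex_face_vertex.
Qed.

Lemma large_realization (R : realType) (gT : finGroupType) d (psi : gT -> 'S_d.+1) :
  (2 < d)%N -> {morph psi : x y / (x * y)%g} -> injective psi ->
  polytopal_realization R gT d.
Proof.
move=> d2 psiM psi_inj; have S_poly := simplex_polytope R d.
have S_cover : facet_cover (simplex_facets d).
  move=> i; have [|iT|/existsP[F /andP[FS iF]]] := or3P (simplex_face_vertex i).
  - by move=> /eqP/setP/(_ i); rewrite !inE eqxx.
  - have := congr1 (fun A : {set 'I_d.+1} => #|A|) (eqP iT).
    by rewrite cards1 cardsT card_ord => -[d0]; rewrite -d0 in d2.
  - by exists F => //; rewrite -finset.sub1set.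
have F0S : [set~ ord0] \in simplex_facets d.
  by apply/mem_simplex_facets; exists ord0.
(* A permutation fixing every vertex of the facet opposite [ord0] also fixes [ord0], which starts
   the induction of [rigid_facet]. *)
have [s s1|I [v [K [a [K_poly aP K_cover [F FK F_rigid]]]]]] :=
  rigid_facet d2 S_poly (simplex_aut_action d) S_cover F0S.
  apply: (aut_action_faithful (simplex_aut_action d)) => i.
  have [->|i0] := eqVneq i ord0; last by apply: s1; rewrite !inE.
  apply/eqP; apply: contraT => s0; have := s1 (simplex_action s ord0).
  rewrite !inE s0 => /(_ isT)/(aut_action_inj (simplex_aut_action d))/eqP.
  by rewrite (negbTE s0).
have [J [w [L [b [L_poly bP L_cover]]]]] :=
  prescribe d2 psiM psi_inj K_poly aP K_cover FK F_rigid.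
apply: (simplicial_realization L_poly bP) => i; have [G GL iG] := L_cover i.
by apply: sub_facet_face GL _; rewrite finset.sub1set.
Qed.

Lemma order2_embedding (gT : finGroupType) : #|gT| = 2%N ->
  exists2 psi : gT -> 'S_2, {morph psi : x y / (x * y)%g} & injective psi.
Proof.
move=> card2; pose t : 'S_2 := tperm ord0 ord_max.
have t1 : t != 1%g.
  by apply/eqP => /permP/(_ ord0); rewrite tpermL perm1 => /(congr1 val).
have uniq_nt (x y : gT) : x != 1%g -> y != 1%g -> x = y.
  move=> x1 y1; apply/eqP; apply: contraT => xy.
  have := subset_leq_card (finset.subsetT (1%g |: [set x; y])).
  by rewrite cardsT card2 cardsU1 cards2 xy !inE ![1%g == _]eq_sym (negbTE x1) (negbTE y1).
exists (fun x => if x == 1%g then 1%g else t).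
  move=> x y; have [->|x1] := eqVneq x 1%g; first by rewrite !mul1g.
  have [->|y1] := eqVneq y 1%g; first by rewrite !mulg1 (negbTE x1).
  have [xy|xy] := eqVneq (x * y)%g 1%g; first by rewrite tperm2.
  have := uniq_nt _ _ xy x1 => /(canRL (mulKg x)); rewrite mulVg => y1'.
  by rewrite y1' eqxx in y1.
move=> x y; have [->|x1] := eqVneq x 1%g; have [->|y1] := eqVneq y 1%g => //.
- by move=> /esym/eqP; rewrite (negbTE t1).
- by move=> /eqP; rewrite (negbTE t1).
- by move=> _; exact: uniq_nt.
Qed.

Lemma injective_card_dvd (gT hT : finGroupType) (psi : gT -> hT) :
  {morph psi : x y / (x * y)%g} -> injective psi -> (#|gT| %| #|hT|)%N.
Proof.
move=> psiM psi_inj; have psiM' : {in [set: gT] &, {morph psi : x y / (x * y)%g}}.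
  by move=> x y _ _; exact: psiM.
have := cardSg (finset.subsetT (Morphism psiM' @* [set: gT])%G).
rewrite card_injm ?subxx // ?cardsT //.
by apply/injmP => x y _ _; exact: psi_inj.
Qed.

Lemma cayley4 (gT : finGroupType) : exists n, (2 < n)%N /\
  exists2 psi : gT -> 'S_n.+1, {morph psi : x y / (x * y)%g} & injective psi.
Proof.
(* Four copies of the regular representation: the degree is at least 4 even for the trivial group,
   so that [2 < n]. *)
pose X : finType := (gT * 'I_4)%type.
have cardX : #|X| = (#|gT| * 4)%N by rewrite card_prod card_ord.
have gT0 : (0 < #|gT|)%N by rewrite (cardD1 1%g).
have X4 : (3 < #|X|)%N by rewrite cardX leq_pmull.
have eX : #|X|.-1.+1 = #|X| by rewrite prednK // (ltn_trans _ X4).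
exists #|X|.-1; split; first by rewrite -ltnS eX.
pose h (x : X) := cast_ord (esym eX) (enum_rank x).
pose h' k : X := enum_val (cast_ord eX k).
have hK : cancel h h' by move=> x; rewrite /h /h' cast_ordKV enum_rankK.
have h'K : cancel h' h by move=> k; rewrite /h /h' enum_valK cast_ordK.
pose f g k := h ((h' k).1 * g, (h' k).2)%g.
have f_inj g : injective (f g).
  move=> k l /(can_inj hK)[/mulIg k1 k2]; apply: (can_inj h'K).
  by rewrite [h' k]surjective_pairing [RHS]surjective_pairing k1 k2.
exists (fun g => perm (f_inj g)).
  by move=> x y; apply/permP => k; rewrite permM !permE /f hK mulgA.
move=> x y /permP/(_ (h (1%g, ord0))); rewrite !permE /f hK !mul1g.
by move=> /(can_inj hK)[].
Qed.

Lemma embedding_realization (R : realType) (gT : finGroupType) n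
    (psi : gT -> 'S_n.+1) :
  {morph psi : x y / (x * y)%g} -> injective psi -> ~ (n = 2%N /\ #|gT| = 3%N) ->
  exists2 d, (d <= n)%N & polytopal_realization R gT d.
Proof.
move=> psiM psi_inj n2.
have [n3|n3] := ltnP 2 n; first by exists n => //; exact: large_realization psiM psi_inj.
have := injective_card_dvd psiM psi_inj; rewrite card_Sn => dvd.
have [c1|nc1] := eqVneq #|gT| 1%N.
  exists 0%N => //; apply: (@simplex_realization R gT 0 (fun=> 1%g)).
  - by move=> x y; rewrite mulg1.
  - by move=> x y _; apply: (fintype_le1P (eq_leq c1)).
  - by rewrite c1.
have n0 : (0 < n)%N.
  by case: n psi psiM psi_inj n2 n3 dvd => // psi _ _ _ _; rewrite dvdn1 (negbTE nc1).
have [c2|nc2] := eqVneq #|gT| 2%N.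
  exists 1%N => //; have [psi2 psi2M psi2_inj] := order2_embedding c2.
  exact: simplex_realization psi2M psi2_inj c2.
exists n => //; apply: (simplex_realization R psiM psi_inj).
case: n n0 n3 n2 dvd {psi psiM psi_inj} => [|[|[|n]]] // _ _ n2 dvd.
  have := dvdn_leq (fact_gt0 2) dvd; move: nc1 nc2 dvd n2.
  by rewrite (_ : 2`! = 2%N) //; case: #|gT| => [|[|[|m]]].
have := dvdn_leq (fact_gt0 3) dvd; move: nc1 nc2 dvd n2.
rewrite (_ : 3`! = 6%N) //; case: #|gT| => [|[|[|[|[|[|[|m]]]]]]] //.
by move=> _ _ _ [].
Qed.

Local Close Scope ring_scope.

Theorem theorem2 (R : realType) (gT : finGroupType) :
  (exists (d : nat) (P : set 'rV[R]_d),
     convex_polytope d.+1 P /\ group_iso gT (order_aut (face_lattice P)))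
  /\
  (forall n : nat,
     (exists phi : {multiplicative gT -> 'S_n.+1}, injective phi) ->
     ~ (n = 2 /\ #|gT| = 3) ->
     exists (d : nat) (disp : Order.disp_t) (Q : finTBPOrderType disp)
            (P : set 'rV[R]_d),
       [/\ (d <= n)%N,
           abstract_polytope d Q,
           group_iso gT (order_aut Q),
           spherical R d Q
         & convex_polytope d.+1 P /\ order_iso Q (face_lattice P)]).
Proof.
split=> [|n [phi phi_inj] n2].
  have [n [n2 [psi psiM psi_inj]]] := cayley4 gT.
  have [disp [Q [P [_ gQ _ [P_poly QP]]]]] := large_realization R n2 psiM psi_inj.
  by exists n, P; split=> //; exact: order_aut_transport QP gQ.
have phiM : {morph phi : x y / (x * y)%g} by move=> x y; rewrite gmulfM.
have [d dn [disp [Q [P [Q1 Q2 Q3 Q4]]]]] :=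
  embedding_realization R phiM phi_inj n2.
by exists d, disp, Q, P.
Qed.
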